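(* Let $V_0>0$ and let $f,g:\mathbb{R}\to\mathbb{R}$ be locally Lipschitz continuous and, with primitives $F(t)=\int_0^t f(s)\,ds$, $G(t)=\int_0^t g(s)\,ds$, satisfy: (1) $f,g$ are continuous; (2) $f(t)=o(t^2)$ and $g(t)=o(t^2)$ as $t\to 0$; (3) there is $\mu>2$ such that $0\le \mu F(t)\le t f(t)$ and $0\le \mu G(t)\le t g(t)$ for all $t\neq 0$; (4) there is $M>0$ such that $0<F(t)\le M|f(t)|$ and $0<G(t)\le M|g(t)|$ for all $t\ne 0$; (5) $t\mapsto f(t)/|t|$ and $t\mapsto g(t)/|t|$ are strictly increasing on $\mathbb{R}\setminus\{0\}$; (6) there is $\beta_0>0$ such that, as $|t|\to\infty$, both $|f(t)|e^{-\beta t^2}$ and $|g(t)|e^{-\beta t^2}$ tend to $0$ for every $\beta>\beta_0$ and to $+\infty$ for every $\beta<\beta_0$; (7) there are $\kappa_0>0$ and $r_1>0$ with $\kappa_0>\max\left\{\frac{8e^{1/2}}{\beta_0}V_0,\frac{\pi}{\beta_0 r_1}\right\}$ such that $\liminf_{|t|\to\infty} t f(t)e^{-\beta_0t^2}\ge\kappa_0$ and $\liminf_{|t|\to\infty} t g(t)e^{-\beta_0t^2}\ge\kappa_0$. Let $w=(u,v)\in H^{1/2}(\mathbb{R})\times H^{1/2}(\mathbb{R})$ be a weak solution of $$(-\Delta)^{1/2}u+V_0u=g(v),\qquad (-\Delta)^{1/2}v+V_0v=f(u)\qquad\text{in }\mathbb{R}.$$ Then $$\int_{\mathbb{R}}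\big(F(u)+G(v)-V_0uv\big)\,dx=0.$$
   Context: With $\langle u,v\rangle_{1/2}=\frac1{2\pi}\iint_{\mathbb{R}^2}\frac{(u(x)-u(y))(v(x)-v(y))}{|x-y|^2}dxdy+V_0\int_{\mathbb{R}}uv\,dx$, a pair $(u,v)\in H^{1/2}(\mathbb{R})\times H^{1/2}(\mathbb{R})$ is a weak solution of the system if $\langle u,\psi\rangle_{1/2}+\langle v,\varphi\rangle_{1/2}=\int_{\mathbb{R}}(f(u)\varphi+g(v)\psi)\,dx$ for all $\varphi,\psi\in H^{1/2}(\mathbb{R})$. *)

(* Defs.v *)
From HB Require Import structures.
From mathcomp Require Import all_boot all_order all_algebra.
From mathcomp Require Import all_classical all_reals all_analysis.
Set Implicit Arguments.
Unset Strict Implicit.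
Unset Printing Implicit Defensive.
Import Order.TTheory GRing.Theory Num.Theory.
Import numFieldNormedType.Exports.
Local Open Scope classical_set_scope.
Local Open Scope ring_scope.

Definition abs_infty (R : realType) : set_system R :=
  [set A | exists M : R, forall t, M < `|t| -> A t].

Arguments abs_infty R : clear implicits.

#[global] Instance abs_infty_filter (R : realType) :
  ProperFilter (abs_infty R).
Proof.
apply: Build_ProperFilter_ex.
  move=> A [M MA]; exists (`|M| + 1); apply: MA.
  by rewrite (ger0_norm (addr_ge0 _ _))// (le_lt_trans (ler_norm M))// ltrDl.
split=> [|A B [M MA] [N NB]|A B AB [M MA]].
- by exists 0.
- exists (Num.max M N) => t; rewrite gt_max => /andP[Mt Nt].
  by split; [exact: MA | exact: NB].
- by exists M => t /MA /AB.
Qed.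

(* The oriented integral of [f] from 0 to [t]; for [t < 0] it is minus the
   integral over [t, 0]. *)
Definition primitive (R : realType) (f : R -> R) (t : R) : R :=
  if 0 <= t then \int[@lebesgue_measure R]_(s in `[0, t]) f s
  else - \int[@lebesgue_measure R]_(s in `[t, 0]) f s.

(* Elements of the Sobolev space are represented by Borel measurable functions
   rather than by their almost-everywhere classes.  On the diagonal the
   quotient is 0, by the convention [0^-1 = 0]; the diagonal is a null set. *)
Definition Hhalf (R : realType) (u : R -> R) : Prop :=
  u \in Lfun (@lebesgue_measure R) 2%:E /\
  (\int[(@lebesgue_measure R) \x (@lebesgue_measure R)]_z
     ((u z.1 - u z.2) ^+ 2 / `|z.1 - z.2| ^+ 2)%:E < +oo)%E.

Definition half_form (R : realType) (V0 : R) (u v : R -> R) : R :=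
  (2 * pi)^-1 *
    (\int[((@lebesgue_measure R) \x (@lebesgue_measure R))%E]_z
       ((u z.1 - u z.2) * (v z.1 - v z.2) / `|z.1 - z.2| ^+ 2)) +
  V0 * \int[@lebesgue_measure R]_x (u x * v x).

(* The right-hand side is an extended-real integral: equality with a real
   number says that the integral exists and is finite, as [\int] of a
   measurable function is finite only if the function is integrable. *)
Definition weak_solution (R : realType) (V0 : R) (f g u v : R -> R) : Prop :=
  [/\ Hhalf u, Hhalf v &
    forall phi psi : R -> R, Hhalf phi -> Hhalf psi ->
      ((half_form V0 u psi + half_form V0 v phi)%:E =
       \int[@lebesgue_measure R]_x
         (f (u x) * phi x + g (v x) * psi x)%:E)%E].

(* Main.v *)
Require Import Defs.
From HB Require Import structures.
From mathcomp Require Import all_boot all_order all_algebra.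
From mathcomp Require Import all_classical all_reals all_analysis.
From mathcomp Require Import measurable_realfun.
From mathcomp Require Import ring lra.
Import Order.TTheory GRing.Theory Num.Theory.
Import numFieldNormedType.Exports.
Local Open Scope classical_set_scope.
Local Open Scope ring_scope.
Set Implicit Arguments.
Unset Strict Implicit.
Unset Printing Implicit Defensive.

(** Dilations leave the half-Laplacian energy on the line invariant, and this is
    exploited without any regularity of u, v beyond boundedness. Let Phi be the
    map that stretches ]-a, a] by the factor 1 + s and translates the two
    remaining half-lines. Testing the equation with u o Phi - u o Phi^-1 and
    v o Phi - v o Phi^-1, the change of variables Phi makes the kinetic terms
    cancel up to s times the energy carried by pairs of points outside
    ]-a, a]^2, and the remaining terms give
    -2 s V0 \int_{]-a, a]} u v on the left and
    -2 s \int_{]-a, a]} (F(u) + G(v)) on the right. For Lipschitz f the errors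
    are O(|| u o Phi - u ||^2) by the trapezoid rule, and this is o(s) for
    every u in H^{1/2}. Let s tend to 0, then a to infinity.

    Lipschitz nonlinearities are enough once u and v are bounded. With t_k the
    level such that |{u > t_k}| is about 2^-k, the Gagliardo energy of the
    slice of u between t_k and t_(k+1) is at least a constant times
    (t_(k+1) - t_k)^2. Summing over k, the gaps are square summable, so
    t_k^2 = o(k) and exp(alpha u^2) is integrable on {u > t_0} for every alpha
    (Trudinger-Moser); in particular g(v) is square integrable where v is
    large. Testing the equation with the slices then gives
    t_(k+1) - t_k <= C \int_{u > t_k} |g(v)|, which decays geometrically. *)

(** * Stretching the line *)

(** The classical multiplier x u'(x) does not exist for u in H^(1/2); u o Phi - u o Phi^-1 stands
    for 2 s x u' and does lie in H^(1/2). Symmetry of this difference is essential: after the change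
    of variables the term of u against v o Phi^-1 meets the term of u o Phi against v, so each
    kinetic term of one equation is cancelled by one of the other; and the nonlinear terms see both
    endpoints u and u o Phi, which gives the trapezoid rule.

    The stretching stops at -a and a so that no point moves by more than s a; this is what makes ||
    u o Phi - u ||^2 small compared with s. The price is an energy defect of order s outside ]-a,
    a]^2, where the kernel and the Jacobian no longer compensate.

    All products are split by AM-GM with a weight eta. The step s is chosen after a and eta and
    disappears on division, leaving a bound C eta + 3 eta^-1 (energy outside the square). Then a is
    taken large for fixed eta, and eta tends to 0 last. *)

Lemma ge0_integral_mrestr d (T : measurableType d) (R : realType)
    (m : {measure set T -> \bar R}) (D : set T) (mD : measurable D)
    (h : T -> \bar R) : measurable_fun setT h -> (forall x, 0 <= h x)%E ->
  (\int[mrestr m mD]_x h x = \int[m]_(x in D) h x)%E.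
Proof.
move=> mh h0.
rewrite -(setUv D) ge0_integral_setU//; last 3 first.
- exact: measurableC.
- by rewrite setUv.
- by apply/disj_set2P; rewrite setICr.
rewrite [X in (_ + X)%E](_ : _ = 0%E) ?adde0.
  apply: eq_measure_integral => A mA AD.
  by rewrite /= /mrestr setIidl.
apply: null_set_integral.
- exact: measurableC.
- exact: measurable_funTS.
- by rewrite /= /mrestr setICl measure0.
Qed.

Section stretch.
Context {R : realType}.
Implicit Types (a s x y : R).
Notation mu := (@lebesgue_measure R).

Definition clamp a x := Num.max (- a) (Num.min a x).

Definition stretch a s x := x + s * clamp a x.

(** A closed form of the inverse: Phi maps [-a, a] onto [-(1 + s) a, (1 + s) a], so [y / (1 + s)]
    clamps to the same value as the preimage of [y]. *)
Definition unstretch a s y := y - s * clamp a (y / (1 + s)).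

(** The almost everywhere derivative of [stretch]. The window is half-open like the intervals []x,
    y]] that generate the Borel sets, so that intersections keep this shape. *)
Definition stretch_deriv a s x := 1 + s * \1_(`]- a, a] : set R) x.

Lemma clamp_cases a x : 0 <= a ->
  [\/ x <= - a /\ clamp a x = - a, - a < x <= a /\ clamp a x = x |
      a < x /\ clamp a x = a].
Proof.
move=> a0; rewrite /clamp.
case: (leP x a) => xa.
  have [ax|xa'] := leP (- a) x.
    move: ax; rewrite le_eqVlt => /predU1P[->|ax]; first by constructor 1.
    by constructor 2; rewrite ax.
  by constructor 1; rewrite ltW.
by constructor 3; split => //; rewrite max_r; lra.
Qed.

Lemma stretchK a s : 0 <= a -> 0 <= s -> cancel (stretch a s) (unstretch a s).
Proof.
move=> a0 s0 x; have s1 : 0 < 1 + s by lra.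
suff -> : unstretch a s (stretch a s x) = stretch a s x - s * clamp a x.
  by rewrite /stretch addrK.
rewrite /unstretch; congr (_ - s * _); rewrite /stretch.
case: (clamp_cases x a0) => -[xa ->].
- have : (x + s * - a) / (1 + s) <= - a by rewrite ler_pdivrMr//; nra.
  case: (clamp_cases ((x + s * - a) / (1 + s)) a0) => -[]//; lra.
- have -> : (x + s * x) / (1 + s) = x by field; rewrite gt_eqF.
  case: (clamp_cases x a0) => -[]//; lra.
- have : a < (x + s * a) / (1 + s) by rewrite ltr_pdivlMr//; nra.
  case: (clamp_cases ((x + s * a) / (1 + s)) a0) => -[]//; lra.
Qed.

Lemma unstretchK a s : 0 <= a -> 0 <= s -> cancel (unstretch a s) (stretch a s).
Proof.
move=> a0 s0 y; have s1 : 0 < 1 + s by lra.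
suff e : clamp a (unstretch a s y) = clamp a (y / (1 + s)).
  by rewrite /stretch e /unstretch subrK.
rewrite /unstretch; set z := y / (1 + s).
have yz : y = z * (1 + s) by rewrite /z divfK// gt_eqF.
rewrite yz; move: z {yz} => z {y}.
case: (clamp_cases z a0) => -[za ->].
- have : z * (1 + s) - s * - a <= - a by nra.
  case: (clamp_cases (z * (1 + s) - s * - a) a0) => -[]//; lra.
- have -> : z * (1 + s) - s * z = z by ring.
  case: (clamp_cases z a0) => -[]//; lra.
- have : a < z * (1 + s) - s * a by nra.
  case: (clamp_cases (z * (1 + s) - s * a) a0) => -[]//; lra.
Qed.

Lemma clampB a x y : 0 <= a -> x <= y ->
  0 <= clamp a y - clamp a x <= y - x.
Proof.
move=> a0 xy.
by case: (clamp_cases x a0) => -[? ->]; case: (clamp_cases y a0) => -[? ->];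
  apply/andP; split; lra.
Qed.

Lemma stretch_lt a s x y : 0 <= a -> 0 <= s ->
  (stretch a s x < stretch a s y) = (x < y).
Proof.
move=> a0 s0; rewrite /stretch; apply/idP/idP; last first.
  by move=> xy; have /andP[] := clampB a0 (ltW xy); nra.
by rewrite !ltNge; apply: contra => yx; have /andP[] := clampB a0 yx; nra.
Qed.

Lemma norm_clamp a x : 0 <= a -> `|clamp a x| <= a.
Proof.
move=> a0; case: (clamp_cases x a0) => -[xa ->].
- by rewrite normrN ger0_norm.
- by rewrite ler_norml; apply/andP; split; lra.
- by rewrite ger0_norm.
Qed.

Lemma measurable_clamp a : measurable_fun setT (clamp a).
Proof. by apply: measurable_maxr => //; apply: measurable_minr. Qed.

Lemma measurable_stretch a s : measurable_fun setT (stretch a s).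
Proof.
apply: measurable_funD => //; apply: measurable_funM => //.
exact: measurable_clamp.
Qed.

Lemma measurable_unstretch a s : measurable_fun setT (unstretch a s).
Proof.
apply: measurable_funB => //; apply: measurable_funM => //.
apply: measurableT_comp; first exact: measurable_clamp.
exact: measurable_funM.
Qed.

Lemma measurable_stretch_deriv a s : measurable_fun setT (stretch_deriv a s).
Proof.
by apply: measurable_funD => //; apply: measurable_funM.
Qed.

Lemma stretch_deriv_ge1 a s x : 0 <= s -> 1 <= stretch_deriv a s x.
Proof. by move=> s0; rewrite /stretch_deriv lerDl mulr_ge0// indicE. Qed.

Lemma stretch_deriv_le a s x : 0 <= s -> stretch_deriv a s x <= 1 + s.
Proof.
by move=> s0; rewrite /stretch_deriv lerD2l ler_piMr// indicE.
Qed.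

Lemma stretch_deriv_ge0 a s x : 0 <= s -> 0 <= stretch_deriv a s x.
Proof. by move=> s0; rewrite (le_trans ler01)// stretch_deriv_ge1. Qed.

(** Here [t] is the difference quotient of [clamp], which is nondecreasing and 1-Lipschitz, and is
    the identity on the window. *)
Lemma stretch_quotient a s x y : 0 <= a -> 0 <= s -> x != y ->
  exists2 t, 0 <= t <= 1 &
    (stretch a s x - stretch a s y = (1 + s * t) * (x - y)) /\
    (- a < x <= a -> - a < y <= a -> t = 1).
Proof.
move=> a0 s0 xy; have xy0 : x - y != 0 by rewrite subr_eq0.
exists ((clamp a x - clamp a y) / (x - y)).
  move: xy xy0; rewrite neq_lt => /orP[] xy xy0.
    have /andP[h1 h2] := clampB a0 (ltW xy).
    have xy' : x - y < 0 by lra.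
    by rewrite ler_ndivlMr// ler_ndivrMr//; apply/andP; split; lra.
  have /andP[h1 h2] := clampB a0 (ltW xy).
  have xy' : 0 < x - y by lra.
  by rewrite ler_pdivlMr// ler_pdivrMr//; apply/andP; split; lra.
split; first by rewrite /stretch; field.
move=> hx hy.
have -> : clamp a x = x by case: (clamp_cases x a0) => -[]//; lra.
have -> : clamp a y = y by case: (clamp_cases y a0) => -[]//; lra.
by rewrite divff.
Qed.

Lemma lebesgue_itvI_clamp a x y : 0 <= a -> x <= y ->
  mu (`]x, y] `&` `]- a, a]) = (clamp a y - clamp a x)%:E.
Proof.
move=> a0 xy.
have -> : `]x, y] `&` `]- a, a] = `]Num.max (- a) x, Num.min a y]%classic.
  apply/seteqP; split => z /=; rewrite !in_itv/= gt_max le_min.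
    by move=> [/andP[-> ->] /andP[-> ->]].
  by move=> /andP[/andP[-> ->] /andP[-> ->]].
rewrite lebesgue_measure_itv/= lte_fin -EFinB; apply/esym.
case: ltP; case: (clamp_cases x a0) => -[hx ->];
  case: (clamp_cases y a0) => -[hy ->]; move: hx hy;
  case: (leP (- a) x); case: (leP a y); intros; congr EFin; lra.
Qed.


End stretch.

Section stretch_integral.
Context {R : realType}.
Implicit Types (a s x y : R).
Notation mu := (@lebesgue_measure R).

(** Phi has corners, so the formula is obtained from uniqueness of Lebesgue measure: [mu] plus [s]
    times its restriction to the window, pushed forward by Phi, gives every interval []x, y]] its
    length. *)
Lemma ge0_integral_stretch a s (h : R -> \bar R) : 0 <= a -> 0 <= s ->
  measurable_fun setT h -> (forall x, 0 <= h x)%E ->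
  (\int[mu]_x (h (stretch a s x) * (stretch_deriv a s x)%:E) =
   \int[mu]_x h x)%E.
Proof.
move=> a0 s0 mh h0.
pose Phi : measurableTypeR R -> measurableTypeR R := stretch a s.
have mPhi : measurable_fun setT Phi by exact: measurable_stretch.
pose Phi_mixin := isMeasurableFun.Build _ _ _ _ _ mPhi.
pose mfPhi : {mfun _ >-> _} := HB.pack Phi Phi_mixin.
have mD : measurable (`]- a, a] : set (measurableTypeR R)).
  exact: measurable_itv.
pose m := measure_add mu (mscale (NngNum s0) (mrestr mu mD)).
pose nu := pushforward m mfPhi.
have mE A : m A = (mu A + s%:E * mu (A `&` `](- a)%R, a]%classic))%E.
  by rewrite /m measure_addE.
have munu A : measurable A -> mu A = nu A.
  apply: lebesgue_measure_unique => _ [[x y] _ <-].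
  rewrite -[LHS]/(mu `]x, y]) -[RHS]/(m (Phi @^-1` `]x, y])).
  have -> : Phi @^-1` `]x, y] = `]unstretch a s x, unstretch a s y]%classic.
    apply/seteqP; split => z /=; rewrite !in_itv/= => /andP[xz zy].
      rewrite -(stretch_lt _ _ a0 s0) unstretchK// xz/= leNgt.
      by rewrite -(stretch_lt _ _ a0 s0) unstretchK// -leNgt.
    rewrite -(unstretchK a0 s0 x) stretch_lt// xz/= leNgt.
    by rewrite -(unstretchK a0 s0 y) stretch_lt// -leNgt.
  rewrite mE.
  have [xy|yx] := ltP x y; last first.
    rewrite [`]x, y]%classic]set_itv_ge ?bnd_simp -?leNgt// measure0.
    rewrite [`]unstretch a s x, _]%classic]set_itv_ge ?bnd_simp; last first.
      by rewrite -leNgt leNgt -(stretch_lt _ _ a0 s0) !unstretchK// -leNgt.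
    by rewrite set0I !measure0 mule0 adde0.
  have xy' : unstretch a s x < unstretch a s y.
    by rewrite -(stretch_lt _ _ a0 s0) !unstretchK.
  rewrite (lebesgue_itvI_clamp a0 (ltW xy')) !lebesgue_measure_itv/= !lte_fin
    xy xy'.
  rewrite -!EFinB -EFinM -EFinD; congr EFin.
  rewrite -{1}(unstretchK a0 s0 x) -{1}(unstretchK a0 s0 y) /stretch; ring.
have mhP : measurable_fun setT (h \o stretch a s).
  by apply: measurableT_comp => //; exact: measurable_stretch.
have hP0 x : (0 <= (h \o stretch a s) x)%E by exact: h0.
transitivity (\int[nu]_x h x)%E; last first.
  by apply: eq_measure_integral => A mA _; exact/esym/munu.
rewrite /nu ge0_integral_pushforward//= preimage_setT.
rewrite ge0_integral_measure_add//= ge0_integral_mscale//=.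
rewrite ge0_integral_mrestr// -ge0_integralZl//=; last exact: measurable_funTS.
rewrite [X in (_ + X)%E]integral_mkcond -ge0_integralD//=.
- apply: eq_integral => x _; rewrite /stretch_deriv EFinD ge0_muleDr ?lee_fin//
  ?mulr_ge0 ?indicE// mule1.
  rewrite patchE; case: ifPn => _; first by rewrite mulr1 muleC.
  by rewrite mulr0 mule0.
- move=> x _; rewrite patchE; case: ifPn => // _.
  by rewrite mule_ge0.
- apply/(measurable_restrictT (fun x => (s%:E * (h \o stretch a s) x)%E) mD).
  by apply: measurable_funTS; exact: measurable_funeM.
Qed.
End stretch_integral.

(** * Real-valued integrable functions and weighted changes of variables *)

Section integrable_extra.
Context d (T : measurableType d) (R : realType).
Variable m : {measure set T -> \bar R}.
Implicit Types f g : T -> R.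

Lemma integrable_dominated f g : measurable_fun setT f ->
  (forall x, `|f x| <= g x) -> m.-integrable setT (EFin \o g) ->
  m.-integrable setT (EFin \o f).
Proof.
move=> mf fg ig; apply: le_integrable ig => //; first exact/measurable_EFinP.
by move=> x _ /=; rewrite lee_fin (le_trans (fg x))// ler_norm.
Qed.

Lemma ge0_integrable f : measurable_fun setT f -> (forall x, 0 <= f x) ->
  (\int[m]_x (f x)%:E < +oo)%E -> m.-integrable setT (EFin \o f).
Proof.
move=> mf f0 fi; apply/integrableP; split; first exact/measurable_EFinP.
by under eq_integral do rewrite /= ger0_norm//.
Qed.

Lemma integrable_measurable f : m.-integrable setT (EFin \o f) ->
  measurable_fun setT f.
Proof. by move=> /measurable_int/measurable_EFinP. Qed.

Lemma integrable_add f g : m.-integrable setT (EFin \o f) ->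
  m.-integrable setT (EFin \o g) ->
  m.-integrable setT (EFin \o (fun x => f x + g x)).
Proof. by move=> fi gi; exact: (integrableD measurableT fi gi). Qed.

Lemma integrable_sub f g : m.-integrable setT (EFin \o f) ->
  m.-integrable setT (EFin \o g) ->
  m.-integrable setT (EFin \o (fun x => f x - g x)).
Proof. by move=> fi gi; exact: (integrableB measurableT fi gi). Qed.

Lemma integrable_scale f c : m.-integrable setT (EFin \o f) ->
  m.-integrable setT (EFin \o (fun x => c * f x)).
Proof. by move=> fi; exact: (integrableZl measurableT c fi). Qed.

Lemma EFin_Rintegral f : m.-integrable setT (EFin \o f) ->
  (\int[m]_x f x)%:E = (\int[m]_x (f x)%:E)%E.
Proof. by move=> fi; rewrite /Rintegral fineK// integrable_fin_num. Qed.

(** A formula known for nonnegative functions passes to integrable ones through positive and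
    negative parts, since the weight [p >= 0] can be moved inside the maximum with 0. *)
Lemma integral_weighted_comp (Phi : T -> T) (p : T -> R) f :
  measurable_fun setT Phi -> measurable_fun setT p -> (forall x, 0 <= p x) ->
  (forall h : T -> \bar R, measurable_fun setT h -> (forall x, 0 <= h x)%E ->
     (\int[m]_x (h (Phi x) * (p x)%:E) = \int[m]_x h x)%E) ->
  m.-integrable setT (EFin \o f) ->
  m.-integrable setT (EFin \o (fun x => f (Phi x) * p x)) /\
  \int[m]_x (f (Phi x) * p x) = \int[m]_x f x.
Proof.
move=> mPhi mp p0 cov fi; have mf := integrable_measurable fi.
have mfP : measurable_fun setT (fun x => f (Phi x) * p x).
  by apply: measurable_funM => //; exact: measurableT_comp mf mPhi.
split.
  apply/integrableP; split; first exact/measurable_EFinP.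
  have /integrableP[_] := fi; apply: le_lt_trans.
  rewrite -[leRHS](cov (fun x => `|f x|%:E)).
  - rewrite le_eqVlt; apply/orP; left; apply/eqP/eq_integral => x _.
    by rewrite /= normrM (ger0_norm (p0 x)).
  - by apply/measurable_EFinP; exact: measurableT_comp.
  - by move=> x; rewrite lee_fin.
congr fine; rewrite integralE [RHS]integralE; congr (_ - _)%E.
- under [RHS]eq_integral do rewrite funeposE -EFin_max.
  rewrite -(cov (fun x => (Num.max (f x) 0)%:E)); last 2 first.
  + by apply/measurable_EFinP; exact: measurable_maxr.
  + by move=> x; rewrite lee_fin le_max lexx orbT.
  apply: eq_integral => x _; rewrite funeposE -EFin_max -EFinM maxr_pMl//.
  by rewrite mul0r.
- under [RHS]eq_integral do rewrite funenegE -EFinN -EFin_max.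
  rewrite -(cov (fun x => (Num.max (- f x) 0)%:E)); last 2 first.
  + by apply/measurable_EFinP; apply: measurable_maxr => //; exact:
    measurable_funN.
  + by move=> x; rewrite lee_fin le_max lexx orbT.
  apply: eq_integral => x _; rewrite funenegE -EFinN -EFin_max -EFinM
    maxr_pMl//.
  by rewrite mul0r mulNr.
Qed.
End integrable_extra.

Section stretch2.
Context {R : realType}.
Notation mu := (@lebesgue_measure R).
Notation mu2 := (mu \x mu)%E.

Definition stretch2 (a s : R) (z : R * R) : R * R :=
  (stretch a s z.1, stretch a s z.2).

Definition stretch2_deriv (a s : R) (z : R * R) : R :=
  stretch_deriv a s z.1 * stretch_deriv a s z.2.

Lemma measurable_stretch2 a s : measurable_fun setT (stretch2 a s).
Proof.
by apply: measurable_fun_pair; apply: measurableT_comp => //;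
  exact: measurable_stretch.
Qed.

Lemma measurable_stretch2_deriv a s : measurable_fun setT (stretch2_deriv a s).
Proof.
by apply: measurable_funM; apply: measurableT_comp => //;
  exact: measurable_stretch_deriv.
Qed.

(** Tonelli, and the formula on the line once in each variable. *)
Lemma ge0_integral_stretch2 a s (h : R * R -> \bar R) : 0 <= a -> 0 <= s ->
  measurable_fun setT h -> (forall z, 0 <= h z)%E ->
  (\int[mu2]_z (h (stretch2 a s z) * (stretch2_deriv a s z)%:E) =
   \int[mu2]_z h z)%E.
Proof.
move=> a0 s0 mh h0.
have p0 x : (0 <= (stretch_deriv a s x)%:E)%E.
  by rewrite lee_fin stretch_deriv_ge0.
rewrite fubini_tonelli1/=; last 2 first.
- apply: emeasurable_funM; first exact: measurableT_comp mh
  (measurable_stretch2 _ _).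
  by apply/measurable_EFinP; exact: measurable_stretch2_deriv.
- by move=> z; rewrite mule_ge0// /stretch2_deriv EFinM mule_ge0.
rewrite [RHS]fubini_tonelli1//.
rewrite -[RHS](@ge0_integral_stretch _ a s)//; last 2 first.
- exact: measurable_fun_fubini_tonelli_F.
- by move=> x; apply: integral_ge0 => y _; exact: h0.
apply: eq_integral => x _; rewrite /fubini_F.
rewrite -(@ge0_integral_stretch _ a s (fun y => h (stretch a s x, y)))//; last
  first.
  exact: measurableT_comp.
rewrite -ge0_integralZr//; last 2 first.
- apply: emeasurable_funM.
    by apply: (measurableT_comp mh); apply: measurable_fun_pair => //;
      exact: measurable_stretch.
  by apply/measurable_EFinP; exact: measurable_stretch_deriv.
- by move=> y _; rewrite mule_ge0.
by apply: eq_integral => y _; rewrite /stretch2_deriv EFinM/= muleA muleAC.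
Qed.

End stretch2.

(** * The space H^(1/2) *)

(** Dominated convergence with majorant |f|. The points have to leave [E n] only where [f] is
    nonzero: the diagonal of the plane lies in all its neighbourhoods, but the Gagliardo quotient is
    0 there. *)
Lemma Rintegral_vanishing d (T : measurableType d) (R : realType)
    (m : {measure set T -> \bar R}) (f : T -> R) (E : nat -> set T) :
  m.-integrable setT (EFin \o f) -> (forall n, measurable (E n)) ->
  (forall x, f x != 0 -> \forall n \near \oo, ~ E n x) ->
  \int[m]_x (f x * \1_(E n) x) @[n --> \oo] --> (0 : R).
Proof.
move=> fi mE Ef; have mf := integrable_measurable fi.
have mfE n : measurable_fun setT (fun x => f x * \1_(E n) x).
  by apply: measurable_funM.
have [] := @dominated_convergence _ _ _ m setT measurableT
  (fun n x => (f x * \1_(E n) x)%:E) (cst 0%E) (fun x => `|f x|%:E).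
- by move=> n; exact/measurable_EFinP.
- exact: measurable_cst.
- apply: aeW => x _; have [fx0|fx0] := eqVneq (f x) 0.
    by under eq_fun do rewrite fx0 mul0r; exact: cvg_cst.
  apply: cvg_near_cst; near=> n; rewrite indicE memNset ?mulr0//.
  by near: n; exact: Ef.
- exact: integrable_norm.
- apply: aeW => x n _ /=; rewrite lee_fin normrM ler_piMr// indicE.
  by case: (_ \in _); rewrite ?normr1 ?normr0.
move=> _ _; rewrite integral0 => /fine_cvgP[_]; apply: cvg_trans.
by apply: near_eq_cvg; near=> n.
Unshelve. all: by end_near. Qed.

Lemma sqrrB_le (R : realFieldType) (x y : R) :
  (x - y) ^+ 2 <= 2 * (x ^+ 2 + y ^+ 2).
Proof. have := sqr_ge0 (x + y); nra. Qed.

Lemma ler_norm_mul (R : realFieldType) (x y e : R) : 0 < e ->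
  `|x * y| <= e * x ^+ 2 + e^-1 * y ^+ 2.
Proof.
move=> e0; rewrite normrM -[x ^+ 2]real_normK ?num_real//.
rewrite -[y ^+ 2]real_normK ?num_real//.
have := normr_ge0 x; have := normr_ge0 y; move: `|x| `|y| => p q q0 p0.
rewrite -(ler_pM2l e0) mulrDr mulVKf ?gt_eqF//.
have := sqr_ge0 (e * p - q); have : 0 <= e * p * q by rewrite !mulr_ge0// ltW.
nra.
Qed.

Section Hhalf_theory.
Context {R : realType}.
Notation mu := (@lebesgue_measure R).
Notation mu2 := (mu \x mu)%E.
Implicit Types u v w : R -> R.

Definition gagliardo u (z : R * R) : R :=
  (u z.1 - u z.2) ^+ 2 / `|z.1 - z.2| ^+ 2.

Lemma gagliardo_ge0 u z : 0 <= gagliardo u z.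
Proof. by rewrite divr_ge0// sqr_ge0. Qed.

Lemma measurable_kernel :
  measurable_fun setT (fun z : R * R => (`|z.1 - z.2| ^+ 2)^-1).
Proof.
(* The inverse is a measurable real power; at 0 both sides are 0. *)
rewrite (_ : (fun _ => _) = (fun t : R => t `^ (-1)) \o
    (fun z : R * R => `|z.1 - z.2| ^+ 2)); last first.
  by apply/funext => z /=; rewrite powR_inv1// sqr_ge0.
apply: measurableT_comp => //; apply: measurable_funX.
by apply: measurableT_comp => //; exact: measurable_funB.
Qed.

Lemma measurable_diff u : measurable_fun setT u ->
  measurable_fun setT (fun z : R * R => u z.1 - u z.2).
Proof. by move=> mf; apply: measurable_funB; exact: measurableT_comp. Qed.

Lemma measurable_bilinear u v :
  measurable_fun setT u -> measurable_fun setT v ->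
  measurable_fun setT (fun z : R * R =>
    (u z.1 - u z.2) * (v z.1 - v z.2) / `|z.1 - z.2| ^+ 2).
Proof.
move=> mfu mfv; apply: measurable_funM; last exact: measurable_kernel.
by apply: measurable_funM; exact: measurable_diff.
Qed.

Lemma measurable_gagliardo u : measurable_fun setT u ->
  measurable_fun setT (gagliardo u).
Proof. by move=> mfu; have := measurable_bilinear mfu mfu. Qed.

Lemma HhalfP u : Hhalf u <-> [/\ measurable_fun setT u,
  mu.-integrable setT (EFin \o (fun x => u x ^+ 2)) &
  mu2.-integrable setT (EFin \o gagliardo u)].
Proof.
split=> [[u2 ui]|[mfu u2 ui]].
  have mfu : measurable_fun setT u by move: u2 => /sub_Lfun_mfun; rewrite inE.
  split => //; first exact: Lfun2_integrable_sqr.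
  apply: ge0_integrable => //; first exact: measurable_gagliardo.
  exact: gagliardo_ge0.
split.
  rewrite inE; apply/andP; split; rewrite inE//= /finite_norm unlock /=.
  have /integrableP[_] := u2.
  under eq_integral do rewrite /= ger0_norm ?sqr_ge0//.
  move=> u2y; apply: poweR_lty.
  apply: le_lt_trans u2y; rewrite le_eqVlt; apply/orP; left; apply/eqP.
  by apply: eq_integral => x _; rewrite powR_mulrn ?normr_ge0// real_normK//
    num_real.
have /integrableP[_] := ui; apply: le_lt_trans.
rewrite le_eqVlt; apply/orP; left; apply/eqP.
by apply: eq_integral => z _; rewrite /= (ger0_norm (gagliardo_ge0 _ _)).
Qed.

Lemma Hhalf_dominated w (A : R -> R) (B : R * R -> R) : measurable_fun setT w ->
  (forall x, w x ^+ 2 <= A x) -> mu.-integrable setT (EFin \o A) ->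
  (forall z, gagliardo w z <= B z) -> mu2.-integrable setT (EFin \o B) ->
  Hhalf w.
Proof.
move=> mw wA iA wB iB; apply/HhalfP; split => //.
- apply: integrable_dominated iA; first exact: measurable_funX.
  by move=> x; rewrite ger0_norm ?sqr_ge0.
- apply: integrable_dominated iB; first exact: measurable_gagliardo.
  by move=> x; rewrite (ger0_norm (gagliardo_ge0 _ _)).
Qed.

(** Normal contractions operate on H^(1/2), as on any Dirichlet space. This supplies -u, |u| and the
    slices between two levels. *)
Lemma Hhalf_contraction u w : Hhalf u -> measurable_fun setT w ->
  (forall x, `|w x| <= `|u x|) -> (forall x y, `|w x - w y| <= `|u x - u y|) ->
  Hhalf w.
Proof.
move=> /HhalfP[mfu u2 ui] mw wu wu2; apply: Hhalf_dominated u2 _ ui => //.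
- by move=> x; rewrite -ler_sqrt ?sqr_ge0// !sqrtr_sqr.
- move=> z; rewrite /gagliardo ler_wpM2r//.
  by rewrite -ler_sqrt ?sqr_ge0// !sqrtr_sqr.
Qed.

Lemma Hhalf0 : Hhalf (fun _ : R => 0 : R).
Proof.
apply/HhalfP; split => //.
- apply: integrable_dominated (integrable0 _ _) => //=.
  by move=> x; rewrite expr0n normr0.
- apply: integrable_dominated (integrable0 _ _) => //=.
    exact: measurable_gagliardo.
  by move=> x; rewrite /gagliardo subrr expr0n mul0r normr0.
Qed.

Lemma HhalfN u : Hhalf u -> Hhalf (fun x => - u x).
Proof.
move=> uH; apply: (Hhalf_contraction uH).
- by have /HhalfP[mfu _ _] := uH; exact: measurable_funN.
- by move=> x; rewrite normrN.
- by move=> x y; rewrite -opprD normrN.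
Qed.

Lemma HhalfB u v : Hhalf u -> Hhalf v -> Hhalf (fun x => u x - v x).
Proof.
move=> /HhalfP[mfu u2 ui] /HhalfP[mfv v2 vi].
apply: (@Hhalf_dominated _ (fun x => 2 * (u x ^+ 2 + v x ^+ 2))
  (fun z => 2 * (gagliardo u z + gagliardo v z))).
- exact: measurable_funB.
- by move=> x; exact: sqrrB_le.
- by apply: integrable_scale; exact: integrable_add.
- move=> z; rewrite /gagliardo -mulrDl mulrA ler_wpM2r//.
  apply: le_trans (sqrrB_le _ _).
  by rewrite le_eqVlt; apply/orP; left; apply/eqP; ring.
- by apply: integrable_scale; exact: integrable_add.
Qed.

Lemma integrable_mulr u v : measurable_fun setT u -> measurable_fun setT v ->
  mu.-integrable setT (EFin \o (fun x => u x ^+ 2)) ->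
  mu.-integrable setT (EFin \o (fun x => v x ^+ 2)) ->
  mu.-integrable setT (EFin \o (fun x => u x * v x)).
Proof.
move=> mfu mfv u2 v2; apply: integrable_dominated (integrable_add u2 v2).
  exact: measurable_funM.
move=> x; apply: (le_trans (ler_norm_mul _ _ ltr01)).
by rewrite invr1 !mul1r.
Qed.

Lemma integrable_bilinear u v : Hhalf u -> Hhalf v ->
  mu2.-integrable setT (EFin \o (fun z : R * R =>
    (u z.1 - u z.2) * (v z.1 - v z.2) / `|z.1 - z.2| ^+ 2)).
Proof.
move=> /HhalfP[mfu u2 ui] /HhalfP[mfv v2 vi].
apply: integrable_dominated (integrable_add ui vi); first exact:
  measurable_bilinear.
move=> z; rewrite /gagliardo -mulrDl normrM (ger0_norm (_ : 0 <= _^-1))//.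
rewrite ler_wpM2r//; apply: (le_trans (ler_norm_mul _ _ ltr01)).
by rewrite invr1 !mul1r.
Qed.

Lemma stretch_dist a s (x y : R) : 0 <= a -> 0 <= s <= 1 ->
  `|x - y| <= `|stretch a s x - stretch a s y| <= 2 * `|x - y|.
Proof.
move=> a0 /andP[s0 s1]; have [->|xy] := eqVneq x y.
  by rewrite !subrr normr0 mulr0 lexx.
have [t /andP[t0 t1] [-> _]] := stretch_quotient a0 s0 xy.
have st0 : 0 <= s * t by rewrite mulr_ge0.
have st1 : s * t <= 1 by rewrite mulr_ile1.
rewrite normrM ger0_norm ?addr_ge0//; have := normr_ge0 (x - y).
by move=> n0; apply/andP; split; nra.
Qed.

Lemma inv_sqr_le (p q : R) : 0 <= p -> 0 < q -> q <= 2 * p ->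
  (p ^+ 2)^-1 <= 4 * (q ^+ 2)^-1.
Proof.
move=> p0 q0 qp; have p1 : 0 < p by lra.
rewrite -[4 * _]invrK lef_pV2 ?posrE ?exprn_gt0//; last first.
  by rewrite invrM ?unitfE ?gt_eqF// ?divr_gt0// ?invr_gt0// exprn_gt0.
rewrite invrM ?unitfE ?gt_eqF// ?invr_gt0 ?exprn_gt0// invrK.
by rewrite ler_pdivrMr//; nra.
Qed.


(* On the diagonal both sides vanish, since 0^-1 = 0. *)
Lemma gagliardo_stretch a s u z : 0 <= a -> 0 <= s <= 1 ->
  gagliardo (u \o stretch a s) z <=
    4 * (gagliardo u (stretch2 a s z) * stretch2_deriv a s z).
Proof.
move=> a0 s01; have /andP[s0 s1] := s01.
apply: (@le_trans _ _ (4 * gagliardo u (stretch2 a s z))); last first.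
  rewrite ler_pM2l// ler_peMr ?gagliardo_ge0// -[leLHS]mul1r.
  by rewrite ler_pM// stretch_deriv_ge1.
rewrite /gagliardo /= mulrCA ler_wpM2l ?sqr_ge0//.
have [->|xy] := eqVneq z.1 z.2; first by rewrite !subrr normr0 expr0n invr0
  mulr0.
have /andP[h1 h2] := stretch_dist z.1 z.2 a0 s01.
apply: inv_sqr_le => //.
by rewrite (lt_le_trans _ h1)// normr_gt0 subr_eq0.
Qed.

(** Evaluating at [stretch2 a s z] removes the inverse from the numerator; the denominators compare
    because Phi never shortens distances. *)
Lemma gagliardo_unstretch a s u z : 0 <= a -> 0 <= s <= 1 ->
  gagliardo (u \o unstretch a s) (stretch2 a s z) <= gagliardo u z.
Proof.
move=> a0 s01; have /andP[s0 s1] := s01.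
rewrite /gagliardo /= !stretchK// ler_wpM2l ?sqr_ge0//.
have [->|xy] := eqVneq z.1 z.2; first by rewrite !subrr.
have /andP[h1 h2] := stretch_dist z.1 z.2 a0 s01.
have xy0 : 0 < `|z.1 - z.2| by rewrite normr_gt0 subr_eq0.
by rewrite lef_pV2 ?posrE ?exprn_gt0 ?(lt_le_trans xy0)// lerXn2r ?nnegrE.
Qed.

Lemma integrable_stretch a s (f : R -> R) : 0 <= a -> 0 <= s ->
  mu.-integrable setT (EFin \o f) ->
  mu.-integrable setT
    (EFin \o (fun x => f (stretch a s x) * stretch_deriv a s x)) /\
  \int[mu]_x (f (stretch a s x) * stretch_deriv a s x) = \int[mu]_x f x.
Proof.
move=> a0 s0 fi; apply: integral_weighted_comp => //.
- exact: measurable_stretch.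
- exact: measurable_stretch_deriv.
- by move=> x; exact: stretch_deriv_ge0.
- by move=> h mh h0; exact: ge0_integral_stretch.
Qed.

Lemma stretch2_deriv_ge0 a s (z : R * R) : 0 <= s -> 0 <= stretch2_deriv a s z.
Proof. by move=> s0; rewrite mulr_ge0// stretch_deriv_ge0. Qed.

Lemma integrable_stretch2 a s (f : R * R -> R) : 0 <= a -> 0 <= s ->
  mu2.-integrable setT (EFin \o f) ->
  mu2.-integrable setT
    (EFin \o (fun z => f (stretch2 a s z) * stretch2_deriv a s z)) /\
  \int[mu2]_z (f (stretch2 a s z) * stretch2_deriv a s z) = \int[mu2]_z f z.
Proof.
move=> a0 s0 fi; apply: integral_weighted_comp => //.
- exact: measurable_stretch2.
- exact: measurable_stretch2_deriv.
- by move=> x; exact: stretch2_deriv_ge0.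
- by move=> h mh h0; exact: ge0_integral_stretch2.
Qed.

Lemma Hhalf_stretch a s u : 0 <= a -> 0 <= s <= 1 -> Hhalf u ->
  Hhalf (u \o stretch a s).
Proof.
move=> a0 s01 /HhalfP[mfu u2 ui]; have /andP[s0 s1] := s01.
have [u2s _] := integrable_stretch a0 s0 u2.
have [uis _] := integrable_stretch2 a0 s0 ui.
apply: Hhalf_dominated u2s _ (integrable_scale 4 uis).
- by apply: measurableT_comp => //; exact: measurable_stretch.
- by move=> x /=; rewrite ler_peMr ?sqr_ge0// stretch_deriv_ge1.
- by move=> z; exact: gagliardo_stretch.
Qed.

(** The change of variables by Phi turns the norms of u o Phi^-1 into integrals weighted by Phi' <=
    1 + s <= 2, whence the factors 2 on the line and 4 in the plane. *)
Lemma Hhalf_unstretch a s u : 0 <= a -> 0 <= s <= 1 -> Hhalf u ->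
  Hhalf (u \o unstretch a s).
Proof.
move=> a0 s01 /HhalfP[mfu u2 ui]; have /andP[s0 s1] := s01.
have mus : measurable_fun setT (u \o unstretch a s).
  by apply: measurableT_comp => //; exact: measurable_unstretch.
apply/HhalfP; split => //.
- apply: ge0_integrable => [|x|]; first exact: measurable_funX.
    exact: sqr_ge0.
  rewrite -(@ge0_integral_stretch _ a s)//; last 2 first.
  + by apply/measurable_EFinP; exact: measurable_funX.
  + by move=> x; rewrite lee_fin sqr_ge0.
  have /integrableP[_] := integrable_scale 2 u2; apply: le_lt_trans.
  apply: ge0_le_integral => //.
  + by move=> x _; rewrite -EFinM lee_fin mulr_ge0 ?sqr_ge0// stretch_deriv_ge0.
  + apply/measurable_EFinP; apply: measurable_funM.
      apply: measurable_funX; apply: measurableT_comp mus _.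
      exact: measurable_stretch.
    exact: measurable_stretch_deriv.
  + apply/measurable_EFinP; apply: measurableT_comp => //.
    by apply: measurable_funM => //; exact: measurable_funX.
  + move=> x _ /=; rewrite stretchK// -EFinM lee_fin ger0_norm; last first.
      by rewrite mulr_ge0// sqr_ge0.
    rewrite mulrC ler_wpM2r ?sqr_ge0// (le_trans (stretch_deriv_le _ _ _))//.
    by lra.
- apply: ge0_integrable => [|x|]; first exact: measurable_gagliardo.
    exact: gagliardo_ge0.
  rewrite -(@ge0_integral_stretch2 _ a s)//; last 2 first.
  + by apply/measurable_EFinP; exact: measurable_gagliardo.
  + by move=> x; rewrite lee_fin gagliardo_ge0.
  have /integrableP[_] := integrable_scale 4 ui; apply: le_lt_trans.
  apply: ge0_le_integral => //.
  + by move=> x _; rewrite -EFinM lee_fin mulr_ge0 ?gagliardo_ge0//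
      stretch2_deriv_ge0.
  + apply/measurable_EFinP; apply: measurable_funM.
      apply: measurableT_comp (measurable_gagliardo mus) _.
      exact: measurable_stretch2.
    exact: measurable_stretch2_deriv.
  + apply/measurable_EFinP; apply: measurableT_comp => //.
    by apply: measurable_funM => //; exact: measurable_gagliardo.
  + move=> z _ /=; rewrite -EFinM lee_fin ger0_norm; last first.
      by rewrite mulr_ge0// gagliardo_ge0.
    rewrite mulrC ler_pM ?gagliardo_ge0 ?stretch2_deriv_ge0//.
      rewrite (_ : 4 = (1 + 1) * (1 + 1)); last by ring.
      by rewrite ler_pM ?stretch_deriv_ge0// (le_trans (stretch_deriv_le _ _
        _))//
        lerD2l.
    exact: gagliardo_unstretch.
Qed.

End Hhalf_theory.

(** * Quantiles and exponential integrability *)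

Section level.
Context {R : realFieldType}.
Implicit Types t e x y : R.

(** For [e >= 0] this is [x - t] cut off to [0, e]; as a difference of minima it combines well over
    bands stacked on each other. *)
Definition level t e x := Num.min x (t + e) - Num.min x t.

Lemma level_mono t e x y : 0 <= e -> y <= x ->
  0 <= level t e x - level t e y <= x - y.
Proof.
move=> e0 yx; rewrite /level.
by case: (leP x (t + e)); case: (leP x t); case: (leP y (t + e));
  case: (leP y t); intros; apply/andP; split; lra.
Qed.

Lemma level_contraction t e x y : 0 <= e ->
  `|level t e x - level t e y| <= `|x - y|.
Proof.
move=> e0; wlog yx : x y / y <= x.
  move=> W; have [|/ltW] := leP y x; first exact: W.
  by move=> xy; rewrite distrC [leRHS]distrC; exact: W.
have /andP[h1 h2] := level_mono t e0 yx.
by rewrite !ger0_norm ?subr_ge0//; lra.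
Qed.

(** A slice is a nondecreasing 1-Lipschitz function of [x]. After division by |x - y|^2, the energy
    of a slice is bounded by the bilinear form of the function with that slice, which is what
    testing an equation with the slice produces. *)
Lemma level_sqr_le t e x y : 0 <= e ->
  (level t e x - level t e y) ^+ 2 <= (x - y) * (level t e x - level t e y).
Proof.
move=> e0; wlog yx : x y / y <= x.
  move=> W; have [|/ltW] := leP y x; first exact: W.
  by move=> /W h; lra.
by have /andP[h1 h2] := level_mono t e0 yx; nra.
Qed.

Lemma level_ge0 t e x : 0 <= e -> 0 <= level t e x.
Proof.
by move=> e0; rewrite /level; case: (leP x (t + e)); case: (leP x t); lra.
Qed.

Lemma level_le t e x : 0 <= e -> level t e x <= e.
Proof.
by move=> e0; rewrite /level; case: (leP x (t + e)); case: (leP x t); lra.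
Qed.

Lemma level_eq0 t e x : 0 <= e -> x <= t -> level t e x = 0.
Proof.
by move=> e0 xt; rewrite /level; case: (leP x (t + e)); case: (leP x t); lra.
Qed.

Lemma level_eq t e x : 0 <= e -> t + e <= x -> level t e x = e.
Proof.
by move=> e0 xt; rewrite /level; case: (leP x (t + e)); case: (leP x t); lra.
Qed.

Lemma norm_level t e x : 0 <= t -> 0 <= e -> `|level t e x| <= `|x|.
Proof.
move=> t0 e0; rewrite ger0_norm ?level_ge0//.
have := ler_norm x; have := normr_ge0 x; move: `|x| => p p0 xp.
by rewrite /level; case: (leP x (t + e)); case: (leP x t); lra.
Qed.

Lemma level_mul_ge0 t e x : 0 <= t -> 0 <= e -> 0 <= x * level t e x.
Proof.
move=> t0 e0; have [xt|tx] := leP x t; first by rewrite level_eq0// mulr0.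
by rewrite mulr_ge0 ?level_ge0//; lra.
Qed.

(** For [y <= x] the increments over disjoint bands are nonnegative with sum at most [x - y], and
    squaring is superadditive on nonnegative numbers. *)
Lemma sum_level_sqr_le (t e : nat -> R) n x y :
  (forall k, 0 <= e k) -> (forall k, t k + e k <= t k.+1) ->
  \sum_(k < n) (level (t k) (e k) x - level (t k) (e k) y) ^+ 2 <=
    (x - y) ^+ 2.
Proof.
move=> e0 te; wlog yx : x y / y <= x.
  move=> W; have [|/ltW] := leP y x; first exact: W.
  move=> /W h; rewrite -[leRHS]sqrrN opprB; apply: le_trans h.
  by apply: ler_sum => k _; rewrite -sqrrN opprB.
(* Capping [x] and [y] at [t n] leaves the room in which the next band, above [t n], is added by
   induction. *)
suff [h1 h2] : \sum_(k < n) (level (t k) (e k) x - level (t k) (e k) y) ^+ 2 <=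
    (Num.min x (t n) - Num.min y (t n)) ^+ 2 /\
    0 <= Num.min x (t n) - Num.min y (t n) <= x - y.
  by apply: (le_trans h1); move: h2 => /andP[]; nra.
split; last first.
  by case: (leP x (t n)); case: (leP y (t n)); intros; apply/andP; split; lra.
elim: n => [|n ih]; first by rewrite big_ord0 sqr_ge0.
rewrite big_ord_recr/=.
apply: (le_trans (lerD ih (lexx _))).
have h0 : 0 <= Num.min x (t n) - Num.min y (t n).
  by case: (leP x (t n)); case: (leP y (t n)); lra.
have /andP[h1 _] := level_mono (t n) (e0 n) yx.
have h2 : Num.min x (t n) - Num.min y (t n) +
    (level (t n) (e n) x - level (t n) (e n) y) <=
    Num.min x (t n.+1) - Num.min y (t n.+1).
  rewrite /level; move: (te n) => ten.
  case: (leP x (t n + e n)); case: (leP y (t n + e n));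
  case: (leP x (t n.+1)); case: (leP y (t n.+1)); lra.
by nra.
Qed.

End level.

Lemma measurable_level (R : realType) (t e : R) :
  measurable_fun setT (level t e).
Proof. by apply: measurable_funB; exact: measurable_minr. Qed.

(** * Energy of a slice between two levels *)

Section superlevel.
Context {R : realType}.
Notation mu := (@lebesgue_measure R).
Notation mu2 := (mu \x mu)%E.
Implicit Types (u w : R -> R) (t e m : R).

Lemma measurable_superlevel w t : measurable_fun setT w ->
  measurable [set x | t < w x].
Proof.
move=> mw; rewrite -[X in measurable X]setTI.
rewrite (_ : [set x | _] = w @^-1` `]t, +oo[%classic); first exact: mw.
by apply/seteqP; split => x /=; rewrite in_itv/= andbT.
Qed.

Lemma Hhalf_level w t e : 0 <= t -> 0 <= e -> Hhalf w -> Hhalf (level t e \o w).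
Proof.
move=> t0 e0 wH; apply: (Hhalf_contraction wH).
- have /HhalfP[mw _ _] := wH; apply: measurableT_comp mw.
  exact: measurable_level.
- by move=> x; exact: norm_level.
- by move=> x y; exact: level_contraction.
Qed.

(* For [x] in the upper level set, at least half of the interval ]x, x + 2m]
   lies in the lower level set. *)
Lemma gagliardo_level_lower w t e m : measurable_fun setT w ->
  0 <= e -> 0 < m -> (mu [set x | (t < w x)%R] <= m%:E)%E ->
  ((e ^+ 2 / (4 * m))%:E * mu [set x | (t + e < w x)%R] <=
   \int[mu2]_z (gagliardo (level t e \o w) z)%:E)%E.
Proof.
move=> mw e0 m0 wm.
have mS := measurable_superlevel (t + e) mw.
have mlw : measurable_fun setT (level t e \o w).
  by apply: measurableT_comp mw; exact: measurable_level.
have mG := measurable_gagliardo mlw.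
have mGE : measurable_fun setT (EFin \o gagliardo (level t e \o w)).
  exact/measurable_EFinP.
have G0 z : (0 <= (EFin \o gagliardo (level t e \o w)) z)%E.
  by rewrite lee_fin gagliardo_ge0.
rewrite -[[set x | _]]setIT -(integral_indic mu measurableT mS).
have mI : measurable_fun setT
    (fun x => (\1_[set x | t + e < w x] x)%:E : \bar R).
  by apply/measurable_EFinP.
rewrite -ge0_integralZl//; last first.
  by rewrite lee_fin divr_ge0 ?sqr_ge0// mulr_ge0// ltW.
rewrite [leRHS]fubini_tonelli1//.
apply: ge0_le_integral => //.
- by move=> x _; rewrite mule_ge0 ?lee_fin ?divr_ge0 ?sqr_ge0// mulr_ge0// ltW.
- by apply: measurable_funeM; apply/measurable_EFinP.
- exact: measurable_fun_fubini_tonelli_F.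
move=> x _; rewrite indicE; have [xS|xS] := boolP (x \in _); last first.
  by rewrite mule0; apply: integral_ge0 => y _; exact: G0.
rewrite mule1 /fubini_F.
pose J : set R := `]x, (x + 2 * m)%R]%classic.
pose Y : set R := ~` [set y | t < w y].
have mY : measurable Y by apply: measurableC; exact: measurable_superlevel.
have mJ : measurable J by exact: measurable_itv.
have muJ : mu J = (2 * m)%:E.
  rewrite lebesgue_measure_itv/= lte_fin ltrDl mulr_gt0// -EFinB.
  by congr EFin; ring.
have mJY : (m%:E <= mu (J `&` Y))%E.
  have : (mu J <= mu (J `&` Y) + m%:E)%E.
    rewrite -{1}(setIT J) -(setUv Y) setIUr.
    apply: (le_trans (measureU2 _ _ _)); [exact: measurableI| |].
      by apply: measurableI => //; exact: measurableC.
    rewrite leeD2l//; apply: le_trans wm; rewrite le_measure ?inE//.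
    + by apply: measurableI => //; exact: measurableC.
    + exact: measurable_superlevel.
    + by rewrite /Y setCK => y [].
  rewrite muJ -leeBlDr// -EFinB; apply: le_trans; rewrite lee_fin; lra.
(* Distances in [J] are at most 2 m, so the quotient is at least e^2 / (4 m^2), on a set of measure
   at least m. *)
apply: (@le_trans _ _ (\int[mu]_(y in J `&` Y) (e ^+ 2 / (4 * m ^+ 2))%:E)%E).
  rewrite integral_cst; last exact: measurableI.
  apply: (@le_trans _ _ ((e ^+ 2 / (4 * m ^+ 2))%:E * m%:E)%E).
    rewrite -EFinM lee_fin le_eqVlt; apply/orP; left; apply/eqP; field.
    by rewrite gt_eqF.
  by rewrite lee_wpmul2l// lee_fin divr_ge0 ?sqr_ge0// mulr_ge0// sqr_ge0.
apply: (@le_trans _ _ (\int[mu]_(y in J `&` Y)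
    (gagliardo (level t e \o w) (x, y))%:E)%E).
  apply: ge0_le_integral => //.
  - exact: measurableI.
  - by move=> y _; rewrite lee_fin divr_ge0 ?sqr_ge0// mulr_ge0// sqr_ge0.
  - by apply: measurable_funTS; apply: measurableT_comp mGE _.
  move=> y [Jy Yy]; rewrite lee_fin /gagliardo/=.
  rewrite (@level_eq _ t e (w x))//; last by move: xS; rewrite inE => /ltW.
  rewrite (@level_eq0 _ t e (w y))//; last by rewrite leNgt; exact/negP.
  move: Jy; rewrite /J /= in_itv/= => /andP[xy yx].
  rewrite subr0 ler_wpM2l ?sqr_ge0//.
  have xy0 : 0 < y - x by lra.
  rewrite distrC gtr0_norm// lef_pV2 ?posrE ?mulr_gt0 ?exprn_gt0//.
  by nra.
apply: ge0_subset_integral => //; first exact: measurableI.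
  by apply: measurableT_comp mGE _.
by move=> y _; rewrite lee_fin gagliardo_ge0.
Qed.

End superlevel.

(** * Dyadic quantiles and their gaps *)

Section quantile.
Context {R : realType}.
Notation mu := (@lebesgue_measure R).
Notation mu2 := (mu \x mu)%E.
Implicit Types (u w : R -> R) (t e : R).

Definition small_level w k : set R :=
  [set t | 0 <= t /\ (mu [set x | (t < w x)%R] <= (2^-1 ^+ k)%:E)%E].

(** The decreasing rearrangement of the positive part of [w], evaluated at 2^-k. *)
Definition quantile w k : R := inf (small_level w k).

Lemma le_superlevel w s t : measurable_fun setT w -> s <= t ->
  (mu [set x | (t < w x)%R] <= mu [set x | (s < w x)%R])%E.
Proof.
move=> mw st; rewrite le_measure ?inE//; try exact: measurable_superlevel.
by move=> x /=; exact: le_lt_trans.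
Qed.

Lemma small_level_neq0 w k : Hhalf w -> small_level w k !=set0.
Proof.
move=> /HhalfP[mw w2 _].
set A := \int[mu]_x (w x ^+ 2).
have A0 : 0 <= A by apply: Rintegral_ge0 => x _; exact: sqr_ge0.
have p0 : 0 < 2^-1 ^+ k :> R by rewrite exprn_gt0.
(* Chebyshev's inequality: the summand 1 gives [t >= 1], so that [t <= w x ^+ 2] where [t < w x],
   and the quotient gives t 2^-k >= A. *)
pose t := A / 2^-1 ^+ k + 1.
have t1 : 1 <= t by rewrite lerDr divr_ge0// ltW.
have t0 : 0 < t by lra.
exists t; split; first exact: ltW.
have mS := measurable_superlevel t mw.
have h : (t%:E * mu [set x | (t < w x)%R] <= A%:E)%E.
  rewrite /A EFin_Rintegral//.
  rewrite -[[set x | _]]setIT -(integral_indic mu measurableT mS).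
  have mI : measurable_fun setT (fun x => (\1_[set x | t < w x] x)%:E : \bar R).
    by apply/measurable_EFinP.
  rewrite -ge0_integralZl//; last by rewrite lee_fin ltW.
  apply: ge0_le_integral => //.
  - by move=> x _; rewrite mule_ge0// lee_fin ltW.
  - by apply: measurable_funeM.
  - by apply/measurable_EFinP; exact: measurable_funX.
  move=> x _; rewrite indicE; have [|_] := boolP (x \in _); last first.
    by rewrite mule0 lee_fin sqr_ge0.
  by rewrite inE/= mule1 lee_fin => tw; nra.
have mufin : (mu [set x | (t < w x)%R] < +oo)%E.
  apply: le_lt_trans (ltry A); apply: le_trans h.
  by rewrite lee_pemull// lee_fin.
move: h; rewrite -[mu _]fineK ?ge0_fin_numE// -EFinM !lee_fin => h.
rewrite -(ler_pM2l t0) (le_trans h)// /t mulrDl divfK ?gt_eqF//.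
by rewrite mul1r lerDl ltW.
Qed.

Lemma quantile_ge0 w k : Hhalf w -> 0 <= quantile w k.
Proof.
by move=> wH; apply: lb_le_inf; [exact: small_level_neq0|move=> t []].
Qed.

Lemma quantileS w k : Hhalf w -> quantile w k <= quantile w k.+1.
Proof.
move=> wH; apply: lb_le_inf; first exact: small_level_neq0.
move=> t [t0 wt]; apply: ge_inf; first by exists 0 => s [].
split => //; apply: (le_trans wt); rewrite lee_fin exprS ler_piMl//.
by rewrite invf_le1// ler1n.
Qed.

Lemma quantile_mono w k n : Hhalf w -> (k <= n)%N ->
  quantile w k <= quantile w n.
Proof.
by move=> wH; apply: (homo_leq (@lexx _ R) le_trans) => i; exact: quantileS.
Qed.

Lemma quantile_gt w k t : Hhalf w -> quantile w k < t ->
  (mu [set x | (t < w x)%R] <= (2^-1 ^+ k)%:E)%E.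
Proof.
move=> wH /inf_lt -/(_ (small_level_neq0 k wH))[s [s0 ws] st].
by apply: le_trans ws; apply: le_superlevel (ltW st); have /HhalfP[] := wH.
Qed.

Lemma quantile_lt w k t : Hhalf w -> 0 <= t -> t < quantile w k ->
  ((2^-1 ^+ k)%:E < mu [set x | (t < w x)%R])%E.
Proof.
move=> wH t0 tq; rewrite ltNge; apply/negP => wt.
by move: tq; apply/negP; rewrite -leNgt; apply: ge_inf => //; exists 0 => s [].
Qed.

(* Only the middle third of the gap between two consecutive quantiles is used,
   so that it does not matter whether the infima are attained. *)
Definition gap w k := quantile w k.+1 - quantile w k.

Definition gap_level w k := level (quantile w k + gap w k / 3) (gap w k / 3).

Lemma gap_ge0 w k : Hhalf w -> 0 <= gap w k.
Proof. by move=> wH; rewrite subr_ge0 quantileS. Qed.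

Lemma Hhalf_gap_level w k : Hhalf w -> Hhalf (gap_level w k \o w).
Proof.
move=> wH; have g0 := gap_ge0 k wH; have q0 := quantile_ge0 k wH.
by apply: Hhalf_level => //; lra.
Qed.

(** The slice has height g / 3 for g = [gap w k]; its lower level lies above the k-th quantile and
    its upper level below the next one. With m = 2^-k and upper mass greater than 2^-(k+1), the
    energy bound is (g / 3)^2 / 8 = g^2 / 72. *)
Lemma gap_sqr_le w k : Hhalf w ->
  gap w k ^+ 2 / 72 <= \int[mu2]_z gagliardo (gap_level w k \o w) z.
Proof.
move=> wH; have := gap_ge0 k wH; rewrite le_eqVlt => /predU1P[<-|g0].
  rewrite expr0n mul0r; apply: Rintegral_ge0 => z _; exact: gagliardo_ge0.
have q0 := quantile_ge0 k wH.
have /HhalfP[mw _ _] := wH.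
have /HhalfP[_ _ iG] := Hhalf_gap_level k wH.
rewrite -lee_fin EFin_Rintegral//.
set q := quantile w k in q0 *; set g := gap w k in g0 *.
have qg : quantile w k.+1 = q + g by rewrite /g /gap; ring.
have h1 : (mu [set x | (q + g / 3 < w x)%R] <= (2^-1 ^+ k)%:E)%E.
  by apply: quantile_gt => //; rewrite -/q; lra.
have h2 : ((2^-1 ^+ k.+1)%:E < mu [set x | (q + g / 3 + g / 3 < w x)%R])%E.
  by apply: quantile_lt => //; rewrite ?qg; lra.
have p0 : 0 < 2^-1 ^+ k :> R by rewrite exprn_gt0.
have g3 : 0 <= g / 3 by lra.
apply: le_trans (gagliardo_level_lower mw g3 p0 h1).
apply: (@le_trans _ _ (((g / 3) ^+ 2 / (4 * 2^-1 ^+ k))%:E * (2^-1 ^+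
  k.+1)%:E)%E).
  rewrite -EFinM lee_fin le_eqVlt; apply/orP; left; apply/eqP.
  rewrite [2^-1 ^+ k.+1]exprS; move: (2^-1 ^+ k) p0 => p p0.
  by field; rewrite gt_eqF.
apply: lee_wpmul2l; last exact: ltW.
by rewrite lee_fin divr_ge0 ?sqr_ge0// mulr_ge0// ltW.
Qed.

(** The middle thirds of the gaps are disjoint bands, so the energies of the slices add up to at
    most the energy of [w]. *)
Lemma sum_gap_sqr_le w n : Hhalf w ->
  \sum_(k < n) gap w k ^+ 2 <= 72 * \int[mu2]_z gagliardo w z.
Proof.
move=> wH; rewrite mulrC -ler_pdivrMr// mulr_suml.
apply: (@le_trans _ _
  (\sum_(k < n) \int[mu2]_z gagliardo (gap_level w k \o w) z)).
  by apply: ler_sum => k _; exact: gap_sqr_le.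
have iG k : mu2.-integrable setT (EFin \o gagliardo (gap_level w k \o w)).
  by have /HhalfP[] := Hhalf_gap_level k wH.
have /HhalfP[mw _ iw] := wH.
have [is_ ->] : mu2.-integrable setT
    (EFin \o (fun z => \sum_(k < n) gagliardo (gap_level w k \o w) z)) /\
    \sum_(k < n) \int[mu2]_z gagliardo (gap_level w k \o w) z =
    \int[mu2]_z (\sum_(k < n) gagliardo (gap_level w k \o w) z).
  elim: n => [|n [ih1 ih2]].
    rewrite big_ord0; split.
      rewrite (_ : EFin \o _ = cst 0%E); first exact: integrable0.
      by apply/funext => z; rewrite /= big_ord0.
    under eq_Rintegral do rewrite big_ord0.
    by rewrite /Rintegral integral0.
  split.
    rewrite (_ : (fun z => _) = (fun z =>
      \sum_(k < n) gagliardo (gap_level w k \o w) z +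
      gagliardo (gap_level w n \o w) z)); first exact: integrable_add.
    by apply/funext => z; rewrite big_ord_recr.
  rewrite big_ord_recr/= ih2 -RintegralD//.
  by apply: eq_Rintegral => z _; rewrite big_ord_recr.
apply: le_Rintegral => // z _.
rewrite /gagliardo -mulr_suml ler_wpM2r//.
apply: (@sum_level_sqr_le _ (fun k => quantile w k + gap w k / 3)
  (fun k => gap w k / 3) n (w z.1) (w z.2)) => k; first by have := gap_ge0 k
    wH; lra.
have := gap_ge0 k wH; have := gap_ge0 k.+1 wH.
rewrite /gap; lra.
Qed.

End quantile.

(** * Exponential integrability of the square *)

Section trudinger_moser.
Context {R : realType}.
Notation mu := (@lebesgue_measure R).
Notation mu2 := (mu \x mu)%E.
Implicit Types (u w z : R -> R).

(** Cauchy-Schwarz for the telescoping sum of the gaps. *)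
Lemma quantile_sqr_growth w m j : Hhalf w ->
  (quantile w (m + j) - quantile w m) ^+ 2 <=
  j%:R * \sum_(m <= k < m + j) gap w k ^+ 2.
Proof.
move=> wH; elim: j => [|j ih]; first by rewrite addn0 subrr expr0n mul0r.
rewrite addnS big_nat_recr ?leq_addr//=.
have -> : quantile w (m + j).+1 - quantile w m =
    (quantile w (m + j) - quantile w m) + gap w (m + j) by rewrite /gap; ring.
have : 0 <= quantile w (m + j) - quantile w m.
  by rewrite subr_ge0 quantile_mono// leq_addr.
have : 0 <= \sum_(m <= k < m + j) gap w k ^+ 2.
  by apply: sumr_ge0 => k _; exact: sqr_ge0.
have := gap_ge0 (m + j) wH; move: ih.
rewrite -natr1; have := ler0n R j.
move: (_ - _) (gap _ _) (\sum_(_ <= _ < _) _) (j%:R : R) => a d s i.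
move=> i0 ais d0 s0 a0.
(* From a^2 <= i s it follows that (2 a d)^2 <= 4 i s d^2 <= (s + i d^2)^2. *)
have : 2 * (a * d) <= s + i * d ^+ 2.
  rewrite -ler_sqr ?nnegrE ?mulr_ge0 ?addr_ge0 ?mulr_ge0 ?sqr_ge0//.
  have := sqr_ge0 (s - i * d ^+ 2); have := ler_wpM2r (sqr_ge0 d) ais.
  nra.
nra.
Qed.

(** Since [delta] can be as small as desired, the decay beats every Gaussian exponent, whatever the
    norm of [w]. *)
Lemma superlevel_sqr_decay w (delta : R) : Hhalf w -> 0 < delta ->
  exists2 D : R, 0 <= D & forall (n : nat) (t : R), 0 <= t ->
    D + delta * n%:R < t ^+ 2 ->
    (mu [set x | (t < w x)%R] <= (2^-1 ^+ n)%:E)%E.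
Proof.
move=> wH d0.
pose S n := \sum_(0 <= k < n) gap w k ^+ 2.
have hS : has_sup (range S).
  split; first by exists (S 0%N), 0%N.
  exists (72 * \int[mu2]_z gagliardo w z) => _ [n _ <-].
  by rewrite /S big_mkord sum_gap_sqr_le.
have d2 : 0 < delta / 2 by lra.
(* Beyond this [m], the squared gaps sum to at most [delta / 2]. *)
have [_ [m _ <-] Sm] := sup_adherent d2 hS.
have Sn n : S n <= sup (range S).
  by apply: ub_le_sup; [case: hS|exists n].
(* With q_k the quantiles, q_n^2 <= 2 q_m^2 + 2 (q_n - q_m)^2, and Cauchy-Schwarz bounds the last
   term by delta n; for n < m, monotonicity gives q_n <= q_m. *)
exists (2 * quantile w m ^+ 2); first by rewrite mulr_ge0 ?sqr_ge0.
move=> n t t0 Dt; apply: quantile_gt => //.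
rewrite -ltr_sqr ?nnegrE ?quantile_ge0//; apply: le_lt_trans Dt.
have n0 := ler0n R n; have qm0 := quantile_ge0 m wH.
have [mn|nm] := leqP m n; last first.
  have qn := quantile_mono wH (ltnW nm); have qn0 := quantile_ge0 n wH.
  have : 0 <= delta * n%:R by rewrite mulr_ge0// ltW.
  by nra.
have := quantile_sqr_growth m (n - m) wH; rewrite subnKC// => h.
have Smn : \sum_(m <= k < n) gap w k ^+ 2 <= delta / 2.
  have : S n = S m + \sum_(m <= k < n) gap w k ^+ 2 by rewrite /S -big_cat_nat.
  by have := Sn n; lra.
have h2 : (n - m)%:R * \sum_(m <= k < n) gap w k ^+ 2 <= n%:R * (delta / 2).
  apply: ler_pM => //; first by apply: sumr_ge0 => k _; exact: sqr_ge0.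
  by rewrite ler_nat leq_subr.
have := le_trans h h2.
have := sqr_ge0 (quantile w n - 2 * quantile w m); nra.
Qed.

Lemma sum_geometric_le (r : R) n : 0 <= r < 1 ->
  \sum_(0 <= k < n) r ^+ k <= (1 - r)^-1.
Proof.
move=> /andP[r0 r1]; have r1' : 0 < 1 - r by lra.
suff -> : \sum_(0 <= k < n) r ^+ k = (1 - r ^+ n) / (1 - r).
  have rn0 := exprn_ge0 n r0.
  by apply: ler_piMl; [rewrite invr_ge0 ltW|lra].
elim: n => [|n ih]; first by rewrite big_geq// expr0 subrr mul0r.
by rewrite big_nat_recr//= ih exprS; field; rewrite gt_eqF.
Qed.

Lemma expR_sqr_integrable z (alpha : R) : Hhalf z -> 0 < alpha ->
  exists2 D : R, 0 <= D & mu.-integrable setT (EFin \o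
    (fun x => expR (alpha * z x ^+ 2) * \1_([set x | D < z x ^+ 2]) x)).
Proof.
move=> zH a0; have /HhalfP[mz _ _] := zH.
(* Chosen so that exp(alpha delta) = 3/2: one step multiplies the exponential by 3/2 and the bound
   on the measure by 1/2, leaving the ratio 3/4. *)
pose delta := ln (3 / 2) / alpha.
have d0 : 0 < delta by rewrite divr_gt0// ln_gt0//; lra.
have az : Hhalf (fun x => `|z x|).
  apply: (Hhalf_contraction zH) => [|x|x y]; first exact: measurableT_comp.
    by rewrite normr_id.
  exact: ler_dist_dist.
have [D0 D0_ge0 hD] := superlevel_sqr_decay az d0.
(* The extra 1 gives the strict inequality that [hD] requires at the square root of D + delta n. *)
pose D := D0 + 1.
have D_ge0 : 0 <= D by rewrite /D; lra.
pose E n := [set x | D + delta * n%:R < z x ^+ 2].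
have mE n : measurable (E n).
  by apply: measurable_superlevel; exact: measurable_funX.
have muE n : (mu (E n) <= (2^-1 ^+ n)%:E)%E.
  have p0 : 0 <= D + delta * n%:R by rewrite addr_ge0// mulr_ge0// ltW.
  apply: le_trans (hD n (Num.sqrt (D + delta * n%:R)) _ _); last 2 first.
  - exact: sqrtr_ge0.
  - by rewrite sqr_sqrtr// /D; lra.
  rewrite le_measure ?inE//.
    exact: mE.
    apply: (@measurable_superlevel _ (fun x => `|z x|)).
    exact: measurableT_comp.
  by move=> x /= zx; rewrite -sqrtr_sqr ltr_sqrt// (le_lt_trans p0).
(* [F n] dominates the integrand on the shell D + delta n < z^2 <= D + delta (n + 1), and every
   point of the domain lies in one shell; so the sum of all [F n] is a majorant. *)
pose F n x := expR (alpha * (D + delta * n.+1%:R)) * \1_(E n) x.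
have F0 n x : 0 <= F n x by rewrite mulr_ge0 ?expR_ge0.
have mF n : measurable_fun setT (fun x => (F n x)%:E).
  by apply/measurable_EFinP; exact: measurable_funM.
have D_E : [set x | D < z x ^+ 2] = E 0%N.
  by rewrite /E mulr0 addr0.
have mG : measurable_fun setT
    (fun x => expR (alpha * z x ^+ 2) * \1_([set x | D < z x ^+ 2]) x).
  apply: measurable_funM; last by rewrite D_E.
  apply: measurableT_comp => //; apply: measurable_funM => //.
  exact: measurable_funX.
exists D => //; apply: ge0_integrable => //.
apply: (@le_lt_trans _ _ (\int[mu]_x (\sum_(n <oo) (F n x)%:E))%E).
  apply: ge0_le_integral => //.
  - exact/measurable_EFinP.
  - by apply: (ge0_emeasurable_sum (h := fun k x => (F k x)%:E)) => [k x _ _|k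
    _]; rewrite ?lee_fin.
  move=> x _; rewrite indicE; have [|_] := boolP (x \in _); last first.
    by rewrite mulr0 nneseries_ge0// => n _ _; rewrite lee_fin.
  rewrite inE/= mulr1 => Dz.
  have [n [zn1 zn2]] : exists n, D + delta * n%:R < z x ^+ 2 /\
      z x ^+ 2 <= D + delta * n.+1%:R.
    have ex : exists n, z x ^+ 2 <= D + delta * n%:R.
      exists (Num.trunc ((z x ^+ 2 - D) / delta)).+1.
      rewrite -lerBlDl -ler_pdivrMl// mulrC; apply/ltW/truncnS_gt.
    case: (ex_minnP ex) => -[|n] zn nmin.
      by move: zn; rewrite mulr0 addr0 leNgt Dz.
    exists n; split=> //; rewrite ltNge; apply/negP => /nmin.
    by rewrite ltnn.
  apply: (@le_trans _ _ (F n x)%:E).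
    rewrite lee_fin /F indicE mem_set// mulr1 ler_expR ler_pM2l//.
  apply: le_trans (nneseries_lim_ge n.+1 _); last first.
    by move=> k _ _; rewrite lee_fin.
  rewrite big_nat_recr//= leeDr// sume_ge0// => k _.
  by rewrite lee_fin.
rewrite integral_nneseries//; last by move=> n x _; rewrite lee_fin.
pose C := expR (alpha * (D + delta)).
apply: (@le_lt_trans _ _ (C * 4)%:E); last exact: ltry.
apply: lime_le.
  by apply: is_cvg_nneseries => n _ _; apply: integral_ge0 => x _; rewrite
    lee_fin.
near=> n.
apply: (@le_trans _ _ (\sum_(0 <= k < n) (C * (3 / 4) ^+ k)%:E)%E).
  apply: lee_sum => k _; rewrite /F.
  under eq_integral do rewrite EFinM.
  rewrite ge0_integralZl//; last by apply/measurable_EFinP; apply: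
    measurable_indic; exact: (mE k).
  rewrite (integral_indic mu measurableT (mE k)) setIT.
  apply: (@le_trans _ _ ((expR (alpha * (D + delta * k.+1%:R)))%:E *
      (2^-1 ^+ k)%:E)%E).
    by apply: lee_wpmul2l => //; exact: muE.
  rewrite -EFinM lee_fin le_eqVlt; apply/orP; left; apply/eqP.
  have -> : alpha * (D + delta * k.+1%:R) = alpha * (D + delta) + ln (3 / 2) *
    k%:R.
    by rewrite /delta -natr1; field; rewrite gt_eqF.
  rewrite expRD mulrC [ln _ * _]mulrC expRM_natl lnK ?posrE; last by lra.
  rewrite /C mulrCA; congr (_ * _); rewrite -exprMn; congr (_ ^+ _).
  by field.
rewrite sumEFin lee_fin -mulr_sumr ler_pM2l ?expR_gt0//.
have r34 : 0 <= (3 / 4 : R) < 1 by apply/andP; split; lra.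
have := sum_geometric_le n r34; have -> // : (1 - 3 / 4)^-1 = 4 :> R by field.
Unshelve. all: by end_near. Qed.

End trudinger_moser.

(** * Boundedness of solutions *)

Section boundedness.
Context {R : realType}.
Notation mu := (@lebesgue_measure R).
Notation mu2 := (mu \x mu)%E.
Implicit Types (h u w z psi : R -> R).

Lemma integrable_indic_finite (A : set R) : measurable A -> (mu A < +oo)%E ->
  mu.-integrable setT (EFin \o (\1_A : R -> R)) /\
  \int[mu]_x (\1_A x) = fine (mu A).
Proof.
move=> mA Ay; have e : (\int[mu]_x (\1_A x)%:E = mu A)%E.
  by rewrite (integral_indic mu measurableT mA) setIT.
split; last by rewrite /Rintegral e.
apply: ge0_integrable => //.
by rewrite e.
Qed.

(* AM-GM: on [A], exp(beta z^2) <= eta exp(2 beta z^2) + 1 / eta, with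
   [eta = (2/3)^k] balancing [mu A <= 2^-k]. *)
Lemma expR_sqr_small_set h z (c beta : R) : measurable_fun setT h -> Hhalf z ->
  0 < beta -> 0 <= c -> (forall x, `|h x| <= c * expR (beta * z x ^+ 2)) ->
  exists2 K : R, 0 <= K & forall (k : nat) (A : set R), measurable A ->
    (mu A <= (2^-1 ^+ k)%:E)%E ->
    mu.-integrable setT (EFin \o (fun x => `|h x| * \1_A x)) /\
    \int[mu]_x (`|h x| * \1_A x) <= K * (3 / 4) ^+ k.
Proof.
move=> mh zH b0 c0 hz.
have b2 : 0 < 2 * beta by lra.
have [D D0 iG] := expR_sqr_integrable zH b2.
set G := fun x => _ in iG.
have G0 x : 0 <= G x by rewrite /G mulr_ge0 ?expR_ge0.
have I0 : 0 <= \int[mu]_x G x by apply: Rintegral_ge0.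
(* The summands pay for the points with z^2 <= D, for the term in [eta] and for the term in 1 /
   [eta]; each of these is a multiple of at most (3/4)^k. *)
exists (c * (expR (beta * D) + \int[mu]_x G x + 1)).
  by rewrite mulr_ge0 ?addr_ge0 ?expR_ge0.
move=> k A mA Ak.
have Ay : (mu A < +oo)%E by apply: le_lt_trans Ak (ltry _).
have [iA eA] := integrable_indic_finite mA Ay.
pose eta : R := (2 / 3) ^+ k.
have eta0 : 0 < eta by rewrite exprn_gt0//; lra.
pose B x := c * ((expR (beta * D) + eta^-1) * \1_A x + eta * G x).
have iB : mu.-integrable setT (EFin \o B).
  by apply/integrable_scale/integrable_add; exact: integrable_scale.
have hB x : `|h x| * \1_A x <= B x.
  have G0x := G0 x.
  rewrite /B indicE; have [xA|xA] := boolP (x \in A); last first.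
    by rewrite !mulr0 add0r mulr_ge0// mulr_ge0// ltW.
  rewrite !mulr1 (le_trans (hz x))// ler_wpM2l//.
  have [zD|Dz] := leP (z x ^+ 2) D.
    apply: (@le_trans _ _ (expR (beta * D))).
      by rewrite ler_expR ler_pM2l.
    by rewrite -addrA lerDl addr_ge0 ?invr_ge0 ?mulr_ge0// ltW.
  have Gx : G x = expR (beta * z x ^+ 2) ^+ 2.
    by rewrite /G indicE mem_set// mulr1 -expRM_natl -mulrA mulr2n; congr expR;
      ring.
  have := ler_norm_mul (expR (beta * z x ^+ 2)) 1 eta0.
  rewrite mulr1 ger0_norm ?expR_ge0// -Gx expr1n mulr1.
  by have := expR_ge0 (beta * D); lra.
have ihA : mu.-integrable setT (EFin \o (fun x => `|h x| * \1_A x)).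
  apply: integrable_dominated iB.
    apply: measurable_funM; first exact: measurableT_comp.
    exact: measurable_indic.
  by move=> x; rewrite ger0_norm// mulr_ge0.
split => //.
apply: (le_trans (le_Rintegral measurableT ihA iB (fun x _ => hB x))).
rewrite /B RintegralZl//; last by apply: integrable_add; exact:
  integrable_scale.
rewrite RintegralD//; [|exact: integrable_scale|exact: integrable_scale].
rewrite !RintegralZl// eA -mulrA ler_wpM2l//.
have muA : fine (mu A) <= 2^-1 ^+ k.
  by rewrite -lee_fin fineK// ge0_fin_numE.
have muA0 : 0 <= fine (mu A) by exact: fine_ge0.
have r2 : 2^-1 ^+ k <= (3 / 4) ^+ k :> R.
  by rewrite lerXn2r ?nnegrE//; lra.
have reta : eta <= (3 / 4) ^+ k by rewrite lerXn2r ?nnegrE//; lra.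
have etam : eta^-1 * fine (mu A) <= (3 / 4) ^+ k.
  apply: (@le_trans _ _ (eta^-1 * 2^-1 ^+ k)).
    by rewrite ler_wpM2l// invr_ge0 ltW.
  rewrite /eta -exprVn -exprMn le_eqVlt; apply/orP; left; apply/eqP.
  by congr (_ ^+ _); field.
have h1 : expR (beta * D) * fine (mu A) <= expR (beta * D) * (3 / 4) ^+ k.
  by rewrite ler_wpM2l ?expR_ge0// (le_trans muA).
have h2 : eta * \int[mu]_x G x <= (3 / 4) ^+ k * \int[mu]_x G x.
  by rewrite ler_wpM2r.
rewrite -[X in _ + eta * X <= _]/(\int[mu]_x G x).
move: h1 h2 etam; move: ((3 / 4) ^+ k) => r.
by lra.
Qed.

(** For [t >= 0] the product of [w] with its slice is nonnegative, so the potential term only helps;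
    [level_sqr_le] treats the kinetic term, and [2 * pi] undoes the normalization. *)
Lemma half_form_level (V0 : R) w t e : 0 <= V0 -> 0 <= t -> 0 <= e -> Hhalf w ->
  \int[mu2]_z gagliardo (level t e \o w) z <=
    2 * pi * half_form V0 w (level t e \o w).
Proof.
move=> V00 t0 e0 wH; have lH := Hhalf_level t0 e0 wH.
have pi0 := pi_gt0 R.
have /HhalfP[_ _ il] := lH.
have ib := integrable_bilinear wH lH.
rewrite /half_form mulrDr mulVKf ?mulf_neq0 ?gt_eqF//.
apply: ler_wpDr.
  apply: mulr_ge0; first by rewrite mulr_ge0// ltW.
  apply: mulr_ge0 => //; apply: Rintegral_ge0 => x _.
  exact: level_mul_ge0.
apply: le_Rintegral => // z _; rewrite /gagliardo ler_wpM2r//.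
exact: level_sqr_le.
Qed.

(** Quantiles see only positive values, so the bound is one-sided; the other side will come from -w
    and -h, which satisfy the same hypotheses. *)
Lemma weak_bounded_above (V0 : R) w h z (c beta : R) : 0 <= V0 -> Hhalf w ->
  measurable_fun setT h -> Hhalf z -> 0 < beta -> 0 <= c ->
  (forall x, `|h x| <= c * expR (beta * z x ^+ 2)) ->
  (forall psi, Hhalf psi ->
    ((half_form V0 w psi)%:E = \int[mu]_x (h x * psi x)%:E)%E) ->
  exists2 B : R, 0 <= B & mu [set x | (B < w x)%R] = 0%E.
Proof.
move=> V00 wH mh zH b0 c0 hz weak.
have /HhalfP[mw _ _] := wH.
have [K K0 hK] := expR_sqr_small_set mh zH b0 c0 hz.
have pi0 := pi_gt0 R.
(* From gap^2 / 72 <= 2 pi (gap / 3) K (3/4)^k, divided by the gap. *)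
pose C := 48 * pi * K.
have C0 : 0 <= C by rewrite !mulr_ge0// ltW.
have gapC k : gap w k <= C * (3 / 4) ^+ k.
  have := gap_ge0 k wH; rewrite le_eqVlt => /predU1P[<-|g0].
    by rewrite mulr_ge0// exprn_ge0//; lra.
  have q0 := quantile_ge0 k wH.
  set t := quantile w k + gap w k / 3; set e := gap w k / 3.
  have t0 : 0 <= t by rewrite /t; lra.
  have e0 : 0 <= e by rewrite /e; lra.
  have h1 := gap_sqr_le k wH.
  have h2 := half_form_level V00 t0 e0 wH.
  have mA := measurable_superlevel t mw.
  have muA : (mu [set x | (t < w x)%R] <= (2^-1 ^+ k)%:E)%E.
    by apply: quantile_gt => //; rewrite /t; lra.
  have [ihA leA] := hK k _ mA muA.
  have lH : Hhalf (level t e \o w) by exact: Hhalf_level.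
  have /HhalfP[mlw _ _] := lH.
  have hle x : `|h x * (level t e \o w) x| <=
      e * (`|h x| * \1_([set x | t < w x]) x).
    rewrite indicE normrM; have [|] := boolP (x \in _).
      rewrite mulr1 mulrC => _ /=; rewrite ler_wpM2r// ger0_norm ?level_ge0//.
      exact: level_le.
    rewrite notin_setE/= => /negP; rewrite -leNgt => wt.
    by rewrite level_eq0// normr0 !mulr0.
  have ih : mu.-integrable setT (EFin \o (fun x => h x * (level t e \o w) x)).
    by apply: integrable_dominated (integrable_scale e ihA) => //; exact:
      measurable_funM.
  have h3 : half_form V0 w (level t e \o w) <= e * (K * (3 / 4) ^+ k).
    rewrite -lee_fin (weak _ lH) -EFin_Rintegral// lee_fin.
    apply: le_trans (ler_wpM2l e0 leA); rewrite -RintegralZl//.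
    apply: le_Rintegral => //; first exact: integrable_scale.
    by move=> x _; exact: le_trans (ler_norm _) (hle x).
  have h4 : gap w k ^+ 2 / 72 <= 2 * pi * (e * (K * (3 / 4) ^+ k)).
    apply: (le_trans h1); apply: (le_trans h2).
    by rewrite ler_wpM2l// mulr_ge0// ltW.
  rewrite -(ler_pM2l g0).
  move: h4; rewrite /C /e; move: ((3 / 4) ^+ k) => r; lra.
have qB n : quantile w n <= quantile w 0%N + C * 4.
  suff : quantile w n <= quantile w 0%N + C * \sum_(0 <= k < n) (3 / 4) ^+ k.
    move=> h1; apply: (le_trans h1); rewrite lerD2l ler_wpM2l//.
    have r34 : 0 <= (3 / 4 : R) < 1 by apply/andP; split; lra.
    by have := sum_geometric_le n r34; have -> : (1 - 3 / 4)^-1 = 4 :> R by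
      field.
  elim: n => [|n ih]; first by rewrite big_geq// mulr0 addr0.
  rewrite big_nat_recr//= mulrDr.
  by have := gapC n; rewrite /gap; lra.
have q0 := quantile_ge0 0 wH.
exists (quantile w 0%N + C * 4 + 1).
  have : 0 <= C * 4 by rewrite mulr_ge0.
  lra.
set B := _ + 1.
(* [B] exceeds all quantiles, so the measure of the superlevel set is below every 2^-n. *)
have muB n : (mu [set x | (B < w x)%R] <= (2^-1 ^+ n)%:E)%E.
  by apply: quantile_gt => //; rewrite /B; have := qB n; lra.
apply/eqP; rewrite eq_le measure_ge0 andbT; apply/lee_addgt0Pr => /= eps eps0.
rewrite add0e.
apply: le_trans (muB (Num.trunc eps^-1).+1) _; rewrite lee_fin.
rewrite exprVn -[leRHS]invrK lef_pV2 ?posrE ?invr_gt0 ?exprn_gt0//.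
apply: le_trans (ltW (truncnS_gt _)) _.
by rewrite -natrX ler_nat ltnW// ltn_expl.
Qed.

End boundedness.

(** * The Pohozaev identity for Lipschitz nonlinearities *)

Section stretch_modulus.
Context {R : realType}.
Notation mu := (@lebesgue_measure R).
Notation mu2 := (mu \x mu)%E.
Implicit Types (u : R -> R) (a s r : R).

(** Only the energy in this strip enters the estimate of u o Phi - u. It tends to 0 with [r], which
    improves O(s) to o(s). *)
Definition near_diagonal r : set (R * R) := [set z | `|z.1 - z.2| <= r].

Lemma measurable_near_diagonal r : measurable (near_diagonal r).
Proof.
rewrite -[near_diagonal r]setTI.
rewrite (_ : near_diagonal r =
  (fun z : R * R => `|z.1 - z.2|) @^-1` `]-oo, r]%classic).
  have m : measurable_fun setT (fun z : R * R => `|z.1 - z.2|).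
    by apply: measurableT_comp => //; exact: measurable_funB.
  exact: m.
by apply/seteqP; split => z /=; rewrite in_itv.
Qed.

Lemma gagliardoM u x y : (u x - u y) ^+ 2 = gagliardo u (x, y) * `|x - y| ^+ 2.
Proof.
rewrite /gagliardo/=; have [->|xy] := eqVneq x y.
  by rewrite !subrr expr0n !mul0r.
by rewrite divfK// expf_neq0// normr_eq0 subr_eq0.
Qed.

(* Compare both u(Phi x) and u(x) with u(y), for y within a s of x, and
   average over y. *)
Lemma stretch_modulus u a s r : Hhalf u -> 0 < a -> 0 < s <= 1 ->
  2 * (s * a) <= r ->
  \int[mu]_x (u (stretch a s x) - u x) ^+ 2 <=
    5 * (s * a) * \int[mu2]_z (gagliardo u z * \1_(near_diagonal r) z).
Proof.
move=> uH a0 /andP[s0 s1] sar; have /HhalfP[mfu u2 ui] := uH.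
have a0' := ltW a0; have s0' := ltW s0.
have s01 : 0 <= s <= 1 by rewrite s0'.
set h := s * a in sar *; have h0 : 0 < h by rewrite mulr_gt0.
have mN := measurable_near_diagonal r.
pose q z := gagliardo u z * \1_(near_diagonal r) z.
have q0 z : 0 <= q z by rewrite mulr_ge0// gagliardo_ge0.
have mq : measurable_fun setT q.
  by apply: measurable_funM; [exact: measurable_gagliardo|exact:
    measurable_indic].
have mqE : measurable_fun setT (EFin \o q) by exact/measurable_EFinP.
have qE0 z : (0 <= (EFin \o q) z)%E by rewrite lee_fin.
have iq : mu2.-integrable setT (EFin \o q).
  apply: integrable_dominated ui => // z; rewrite ger0_norm// /q indicE.
  by case: (_ \in _); rewrite ?mulr1 ?mulr0 ?gagliardo_ge0.
have /HhalfP[mfuP uP2 _] := Hhalf_stretch a0' s01 uH.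
pose m x := (u (stretch a s x) - u x) ^+ 2.
have im : mu.-integrable setT (EFin \o m).
  apply: integrable_dominated (integrable_scale 2 (integrable_add uP2 u2)).
    by apply: measurable_funX; exact: measurable_funB.
  by move=> x; rewrite ger0_norm ?sqr_ge0// /m; exact: sqrrB_le.
pose Q x := (\int[mu]_y (q (x, y))%:E)%E.
have Q0 x : (0 <= Q x)%E by apply: integral_ge0 => y _; rewrite lee_fin.
have mQ : measurable_fun setT Q.
  exact: (measurable_fun_fubini_tonelli_F (m2 := mu) (EFin \o q)).
have mQP : measurable_fun setT (Q \o stretch a s).
  by apply: measurableT_comp mQ _; exact: measurable_stretch.
have e8 : (0 <= (8 * h ^+ 2)%:E :> \bar R)%E by rewrite lee_fin mulr_ge0
  ?sqr_ge0.
have e2 : (0 <= (2 * h ^+ 2)%:E :> \bar R)%E by rewrite lee_fin mulr_ge0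
  ?sqr_ge0.
have pointwise x : ((2 * h * m x)%:E <=
    (8 * h ^+ 2)%:E * Q (stretch a s x) + (2 * h ^+ 2)%:E * Q x)%E.
  pose J : set R := `[x - h, x + h]%classic.
  have mJ : measurable J by exact: measurable_itv.
  have mq1 t : measurable_fun setT (fun y => (q (t, y))%:E : \bar R).
    exact: measurableT_comp mqE (measurable_pair1 _).
  have q1 t (y : R) : setT y -> (0 <= (q (t, y))%:E)%E by rewrite lee_fin.
  rewrite /Q -(ge0_integralZl mu measurableT (mq1 (stretch a s x)) (q1 _) e8).
  rewrite -(ge0_integralZl mu measurableT (mq1 x) (q1 _) e2).
  rewrite -ge0_integralD//; last 4 first.
  - by move=> y _; rewrite mule_ge0// lee_fin.
  - by apply: measurable_funeM; exact: mq1.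
  - by move=> y _; rewrite mule_ge0// lee_fin.
  - by apply: measurable_funeM; exact: mq1.
  apply: (@le_trans _ _ (\int[mu]_y ((m x)%:E * (\1_J y)%:E))%E).
    rewrite ge0_integralZl//; last 2 first.
    - by apply/measurable_EFinP; exact: measurable_indic.
    - by rewrite lee_fin sqr_ge0.
    have muJ : mu J = (2 * h)%:E.
      rewrite lebesgue_measure_itv/= lte_fin ifT; last by lra.
      by rewrite -EFinB; congr EFin; ring.
    rewrite (integral_indic mu measurableT mJ) setIT.
    apply: (@le_trans _ _ ((m x)%:E * (2 * h)%:E)%E); first by rewrite -EFinM
      mulrC.
    by rewrite -muJ.
  apply: ge0_le_integral => //.
  - by move=> y _; rewrite mule_ge0// lee_fin sqr_ge0.
  - by apply: measurable_funeM; apply/measurable_EFinP; exact: measurable_indic.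
  - by apply: emeasurable_funD; apply: measurable_funeM; exact: mq1.
  move=> y _; rewrite -!EFinM -EFinD lee_fin indicE.
  have [|_] := boolP (y \in J); last first.
    by rewrite mulr0 addr_ge0// mulr_ge0// mulr_ge0 ?sqr_ge0.
  rewrite inE /J/= in_itv/= mulr1 => /andP[xy yx].
  have xy1 : `|x - y| <= h by rewrite ler_norml; apply/andP; split; lra.
  have Px : `|stretch a s x - y| <= 2 * h.
    rewrite (_ : _ - y = s * clamp a x + (x - y)); last by rewrite /stretch;
      ring.
    rewrite (le_trans (ler_normD _ _))// mulrDl mul1r lerD//.
    by rewrite normrM ger0_norm// ler_wpM2l// norm_clamp.
  have -> : q (stretch a s x, y) = gagliardo u (stretch a s x, y).
    by rewrite /q indicE mem_set ?mulr1// /near_diagonal/= (le_trans Px).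
  have -> : q (x, y) = gagliardo u (x, y).
    by rewrite /q indicE mem_set ?mulr1// /near_diagonal/= (le_trans xy1)//;
      lra.
  have := sqrrB_le (u (stretch a s x) - u y) (u x - u y).
  rewrite (_ : _ - _ = u (stretch a s x) - u x); last by ring.
  rewrite -/(m x) !gagliardoM => mle; apply: (le_trans mle); rewrite mulrDr.
  have G1 := gagliardo_ge0 u (stretch a s x, y).
  have G2 := gagliardo_ge0 u (x, y).
  have P1 : `|stretch a s x - y| ^+ 2 <= 4 * h ^+ 2.
    by have := normr_ge0 (stretch a s x - y); nra.
  have P2 : `|x - y| ^+ 2 <= h ^+ 2 by have := normr_ge0 (x - y); nra.
  have := ler_wpM2l G1 P1; have := ler_wpM2l G2 P2; lra.
have QE : (\int[mu]_x Q x = (\int[mu2]_z q z)%:E)%E.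
  by rewrite EFin_Rintegral// [RHS]fubini_tonelli1.
(* The density Phi' >= 1 may be inserted for free. *)
have QP : (\int[mu]_x Q (stretch a s x) <= \int[mu]_x Q x)%E.
  rewrite -[leRHS](@ge0_integral_stretch _ a s)//; apply: ge0_le_integral => //.
  - apply: emeasurable_funM => //.
    by apply/measurable_EFinP; exact: measurable_stretch_deriv.
  - by move=> x _; rewrite lee_pemulr// lee_fin stretch_deriv_ge1.
have : ((2 * h * \int[mu]_x m x)%:E <=
    (8 * h ^+ 2 * \int[mu2]_z q z + 2 * h ^+ 2 * \int[mu2]_z q z)%:E)%E.
  rewrite -RintegralZl// EFin_Rintegral; last exact: integrable_scale.
  apply: (@le_trans _ _ (\int[mu]_x ((8 * h ^+ 2)%:E * Q (stretch a s x) +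
      (2 * h ^+ 2)%:E * Q x))%E).
    apply: ge0_le_integral => //.
    - by move=> x _; rewrite lee_fin mulr_ge0 ?sqr_ge0// mulr_ge0// ltW.
    - by apply/measurable_EFinP; apply: measurable_funM => //;
        exact: integrable_measurable im.
    - by apply: emeasurable_funD; exact: measurable_funeM.
  rewrite ge0_integralD//; last 4 first.
  - by move=> x _; rewrite mule_ge0.
  - exact: measurable_funeM.
  - by move=> x _; rewrite mule_ge0.
  - exact: measurable_funeM.
  rewrite (ge0_integralZl mu measurableT mQP (fun x _ => Q0 _) e8).
  rewrite (ge0_integralZl mu measurableT mQ (fun x _ => Q0 x) e2).
  rewrite EFinD; apply: leeD; rewrite [leRHS]EFinM -QE; last exact: lexx.
  exact: (lee_wpmul2l e8 QP).
rewrite lee_fin -/m => H; rewrite -(@ler_pM2l _ (2 * h)) ?mulr_gt0//.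
apply: (le_trans H); rewrite -/q.
by rewrite le_eqVlt; apply/orP; left; apply/eqP; ring.
Qed.

End stretch_modulus.

(** * First-order defects of the kinetic, linear and nonlinear terms under stretching *)

Section defects.
Context {R : realType}.
Notation mu := (@lebesgue_measure R).
Notation mu2 := (mu \x mu)%E.
Implicit Types (u v : R -> R) (a s eta : R).

Definition window a : set R := `]- a, a]%classic.

Definition outside a : set (R * R) := ~` (window a `*` window a).

Lemma measurable_window a : measurable (window a).
Proof. exact: measurable_itv. Qed.

Lemma measurable_outside a : measurable (outside a).
Proof. by apply: measurableC; apply: measurableX; exact: measurable_window. Qed.

Lemma stretch_derivE a s x : stretch_deriv a s x = 1 + s * \1_(window a) x.
Proof. by []. Qed.

Lemma integrable_indicM d (T : measurableType d) (m : {measure set T -> \bar R})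
    (A : set T) (f : T -> R) : measurable A ->
  m.-integrable setT (EFin \o f) ->
  m.-integrable setT (EFin \o (fun x => \1_A x * f x)).
Proof.
move=> mA fi; have mf := integrable_measurable fi.
apply: integrable_dominated (integrable_norm fi).
  by apply: measurable_funM => //; exact: measurable_indic.
by move=> x; rewrite normrM ler_piMl// indicE; case: (_ \in _);
  rewrite ?normr1 ?normr0.
Qed.

Definition bil u v (z : R * R) : R :=
  (u z.1 - u z.2) * (v z.1 - v z.2) / `|z.1 - z.2| ^+ 2.

(** The kernel is homogeneous of degree -2, so on the square of the window, where Phi is a dilation,
    it absorbs the Jacobian (1 + s)^2 exactly. *)
Lemma jacobian_defect a s (x y : R) : 0 <= a -> 0 <= s <= 1 ->
  `|stretch2_deriv a s (x, y) / `|stretch a s x - stretch a s y| ^+ 2 -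
    (`|x - y| ^+ 2)^-1| <= 3 * s * \1_(outside a) (x, y) / `|x - y| ^+ 2.
Proof.
move=> a0 /andP[s0 s1]; have [->|xy] := eqVneq x y.
  by rewrite !subrr normr0 expr0n invr0 !mulr0 subrr normr0.
have [t /andP[t0 t1] [-> tD]] := stretch_quotient a0 s0 xy.
have xy0 : 0 < `|x - y| by rewrite normr_gt0 subr_eq0.
have st0 : 0 < 1 + s * t by rewrite ltr_wpDr// mulr_ge0.
rewrite normrM exprMn (ger0_norm (ltW st0)).
have -> : stretch2_deriv a s (x, y) / ((1 + s * t) ^+ 2 * `|x - y| ^+ 2) -
    (`|x - y| ^+ 2)^-1 =
    (stretch2_deriv a s (x, y) / (1 + s * t) ^+ 2 - 1) / `|x - y| ^+ 2.
  by field; rewrite !gt_eqF.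
rewrite normrM (ger0_norm (_ : 0 <= (`|x - y| ^+ 2)^-1))//.
rewrite ler_wpM2r// indicE /stretch2_deriv/= !stretch_derivE !indicE.
have [out|] := boolP ((x, y) \in outside a); last first.
  rewrite notin_setE /outside /= => /contrapT[/= wx wy].
  rewrite !mem_set// !mulr1 mulr0.
  have -> : t = 1 by apply: tD; [move: wx|move: wy]; rewrite /window/= in_itv.
  rewrite mulr1 (_ : _ - 1 = 0) ?normr0//; field.
  by rewrite gt_eqF//; lra.
rewrite mulr1.
have -> p q : (1 + s * p) * (1 + s * q) / (1 + s * t) ^+ 2 - 1 =
   ((1 + s * p) * (1 + s * q) - (1 + s * t) ^+ 2) / (1 + s * t) ^+ 2.
  by field; rewrite gt_eqF.
have D1 : 1 <= (1 + s * t) ^+ 2 by rewrite exprn_ege1// lerDl mulr_ge0.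
rewrite normrM normfV [X in _ / X]ger0_norm ?sqr_ge0// ler_pdivrMr; last by lra.
have h1 : 0 <= s * t by rewrite mulr_ge0.
have h2 : s * t <= s by rewrite ler_piMr.
(* Both products lie between 1 and (1 + s)^2, and (1 + s)^2 - 1 <= 3 s as s <= 1. *)
apply: (@le_trans _ _ (3 * s)); last by rewrite ler_peMr// mulr_ge0.
by case: (x \in _); case: (y \in _);
  rewrite /= ?mulr1 ?mulr0 ler_norml; apply/andP; split; nra.
Qed.

(** After the change of variables both integrands share the factor (u(Phi x) - u(Phi y)) (v x - v
    y), and the difference of the kernels is a [jacobian_defect]. The large weight [eta^-1] falls on
    the energy outside the square alone, which is small for large [a]. *)
Lemma kinetic_defect a s eta u v : 0 <= a -> 0 <= s <= 1 -> 0 < eta ->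
  Hhalf u -> Hhalf v ->
  `|\int[mu2]_z bil u (v \o unstretch a s) z -
    \int[mu2]_z bil (u \o stretch a s) v z| <=
  3 * s * (4 * eta * \int[mu2]_z gagliardo u z +
    eta^-1 * \int[mu2]_z (\1_(outside a) z * gagliardo v z)).
Proof.
move=> a0 s01 eta0 uH vH; have /andP[s0 s1] := s01.
have uPH := Hhalf_stretch a0 s01 uH.
have vQH := Hhalf_unstretch a0 s01 vH.
have i1 := integrable_bilinear uH vQH.
have i2 := integrable_bilinear uPH vH.
have [i3 e3] := integrable_stretch2 a0 s0 i1.
have /HhalfP[_ _ iu] := uH.
have /HhalfP[_ _ iv] := vH.
have [iu4 eu4] := integrable_stretch2 a0 s0 iu.
have mo : measurable (outside a : set (measurableTypeR R * measurableTypeR R)).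
  exact: measurable_outside.
have iv4 := integrable_indicM mo iv.
rewrite -[X in X - _]e3 -RintegralB//.
set F := fun z => _ - _.
have iF : mu2.-integrable setT (EFin \o F) by exact: integrable_sub.
set G := fun z => 3 * s * (eta * (4 * (gagliardo u (stretch2 a s z) *
  stretch2_deriv a s z)) + eta^-1 * (\1_(outside a) z * gagliardo v z)).
have iG : mu2.-integrable setT (EFin \o G).
  by apply/integrable_scale/integrable_add; repeat apply: integrable_scale.
have FG z : `|F z| <= G z.
  case: z => x y; rewrite /F /G /= !stretchK//.
  have -> : (u (stretch a s x) - u (stretch a s y)) * (v x - v y) /
      `|stretch a s x - stretch a s y| ^+ 2 * stretch2_deriv a s (x, y) -
      (u (stretch a s x) - u (stretch a s y)) * (v x - v y) / `|x - y| ^+ 2 =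
    (u (stretch a s x) - u (stretch a s y)) * (v x - v y) *
    (stretch2_deriv a s (x, y) / `|stretch a s x - stretch a s y| ^+ 2 -
      (`|x - y| ^+ 2)^-1) by ring.
  rewrite normrM.
  apply: (le_trans (ler_wpM2l _ (jacobian_defect x y a0 s01))) => //.
  have e0 := ltW eta0.
  have k0 : 0 <= (`|x - y| ^+ 2)^-1 by rewrite invr_ge0 sqr_ge0.
  have h := ler_wpM2r k0 (ler_norm_mul (u (stretch a s x) - u (stretch a s y))
    (v x - v y) eta0).
  rewrite (mulrDl (eta * _)) -(mulrA eta) -(mulrA eta^-1) in h.
  have gu := ler_wpM2l e0 (gagliardo_stretch u (x, y) a0 s01).
  have P0 : 0 <= 4 * (gagliardo u (stretch2 a s (x, y)) * stretch2_deriv a s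
    (x, y)).
    by rewrite mulr_ge0// mulr_ge0 ?gagliardo_ge0 ?stretch2_deriv_ge0.
  rewrite indicE; case: (_ \in _); last first.
    rewrite /= mulr0n !(mulr0, mul0r, addr0).
    by apply: mulr_ge0; exact: mulr_ge0.
  rewrite /= mulr1n mulr1 mul1r mulrCA ler_wpM2l ?mulr_ge0//.
  by apply: (le_trans h); rewrite lerD.
apply: (le_trans (le_normr_Rintegral measurableT iF)).
apply: (@le_trans _ _ (\int[mu2]_z G z)).
  by apply: le_Rintegral => //; exact: integrable_norm.
rewrite /G RintegralZl//; last by apply: integrable_add; repeat apply:
  integrable_scale.
rewrite RintegralD//; [|by repeat apply: integrable_scale|exact:
  integrable_scale].
rewrite !RintegralZl//; last exact: integrable_scale.
by rewrite eu4 mulrCA mulrA.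
Qed.

End defects.

Section defects.
Context {R : realType}.
Notation mu := (@lebesgue_measure R).
Notation mu2 := (mu \x mu)%E.
Implicit Types (u v : R -> R) (a s eta : R).

Lemma integral_mul_unstretch a s u v : 0 <= a -> 0 <= s ->
  mu.-integrable setT (EFin \o (fun x => u x * (v \o unstretch a s) x)) ->
  mu.-integrable setT (EFin \o
    (fun x => (u \o stretch a s) x * v x * stretch_deriv a s x)) /\
  \int[mu]_x (u x * (v \o unstretch a s) x) =
  \int[mu]_x ((u \o stretch a s) x * v x * stretch_deriv a s x).
Proof.
move=> a0 s0 i; have [i' <-] := integrable_stretch a0 s0 i.
have e : (fun x => u (stretch a s x) * (v \o unstretch a s) (stretch a s x) *
    stretch_deriv a s x) =
    (fun x => (u \o stretch a s) x * v x * stretch_deriv a s x).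
  by apply/funext => x; rewrite /= stretchK.
by split; [rewrite -e|rewrite -e].
Qed.

Lemma integral_stretch_sqr_le a s u : 0 <= a -> 0 <= s <= 1 -> Hhalf u ->
  \int[mu]_x ((u \o stretch a s) x ^+ 2) <= \int[mu]_x (u x ^+ 2).
Proof.
move=> a0 s01 uH; have /andP[s0 s1] := s01.
have /HhalfP[_ u2 _] := uH.
have /HhalfP[_ uP2 _] := Hhalf_stretch a0 s01 uH.
have [i <-] := integrable_stretch a0 s0 u2.
apply: le_Rintegral => // x _.
by rewrite /= ler_peMr ?sqr_ge0// stretch_deriv_ge1.
Qed.

Lemma integrable_diff_stretch a s u : 0 <= a -> 0 <= s <= 1 -> Hhalf u ->
  mu.-integrable setT (EFin \o (fun x => (u (stretch a s x) - u x) ^+ 2)).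
Proof.
move=> a0 s01 uH.
have /HhalfP[] := HhalfB (Hhalf_stretch a0 s01 uH) uH.
by [].
Qed.

(** After the change of variables the left-hand side is exactly -s times the integral over the
    window of u (v o Phi - v). *)
Lemma cross_defect a s eta u v : 0 <= a -> 0 <= s <= 1 -> 0 < eta ->
  Hhalf u -> Hhalf v ->
  `|\int[mu]_x (u x * (v \o stretch a s) x) -
    \int[mu]_x (v x * (u \o unstretch a s) x) +
    s * \int[mu]_x (\1_(window a) x * (u x * v x))| <=
  s * (eta * \int[mu]_x (u x ^+ 2) +
       eta^-1 * \int[mu]_x (v (stretch a s x) - v x) ^+ 2).
Proof.
move=> a0 s01 eta0 uH vH; have /andP[s0 s1] := s01.
have vPH := Hhalf_stretch a0 s01 vH.
have uQH := Hhalf_unstretch a0 s01 uH.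
have /HhalfP[mfu u2 _] := uH; have /HhalfP[mfv v2 _] := vH.
have /HhalfP[mvP vP2 _] := vPH; have /HhalfP[muQ uQ2 _] := uQH.
have mw : measurable (window a : set (measurableTypeR R)).
  exact: measurable_window.
have i1 := integrable_mulr mfu mvP u2 vP2.
have i2 := integrable_mulr mfv muQ v2 uQ2.
have [i3 ->] := integral_mul_unstretch a0 s0 i2.
have i4 := integrable_indicM mw (integrable_mulr mfu mfv u2 v2).
have i5 := integrable_diff_stretch a0 s01 vH.
rewrite -RintegralB// -RintegralZl// -RintegralD//; last 2 first.
- exact: integrable_sub.
- exact: integrable_scale.
set G := fun x => s * (eta * u x ^+ 2 + eta^-1 * (v (stretch a s x) - v x) ^+
  2).
have iG : mu.-integrable setT (EFin \o G).
  by apply: integrable_scale; apply: integrable_add; exact: integrable_scale.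
set F := fun x => _ + _.
have iF : mu.-integrable setT (EFin \o F).
  by apply: integrable_add; [exact: integrable_sub|exact: integrable_scale].
have FG x : `|F x| <= G x.
  rewrite /F /G stretch_derivE /=.
  rewrite [X in `|X| <= _](_ : _ = s * (- \1_(window a) x * (u x * (v (stretch
    a s x) - v x))));
    last by ring.
  rewrite normrM ger0_norm// ler_wpM2l// normrM.
  apply: le_trans (ler_norm_mul _ _ eta0).
  rewrite ler_piMl// normrN indicE; case: (_ \in _); by rewrite ?normr1 ?normr0.
apply: (le_trans (le_normr_Rintegral measurableT iF)).
apply: (@le_trans _ _ (\int[mu]_x G x)).
  by apply: le_Rintegral => //; exact: integrable_norm.
rewrite /G RintegralZl//; last by apply: integrable_add; exact:
  integrable_scale.
by rewrite RintegralD ?RintegralZl//; exact: integrable_scale.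
Qed.

(* Trapezoid rule: (f p + f q) (q - p) equals 2 (F q - F p) up to
   O((q - p)^2). *)
Lemma nonlinear_defect (L : R) (f F : R -> R) a s eta u :
  0 <= L -> measurable_fun setT f -> measurable_fun setT F ->
  (forall t, `|f t| <= L * `|t|) -> (forall t, `|F t| <= L * t ^+ 2) ->
  (forall p q, `|F q - F p - f p * (q - p)| <= L * (q - p) ^+ 2) ->
  0 <= a -> 0 <= s <= 1 -> 0 < eta -> Hhalf u ->
  `|\int[mu]_x ((f \o u) x * (u \o stretch a s) x) -
    \int[mu]_x ((f \o u) x * (u \o unstretch a s) x) +
    2 * s * \int[mu]_x (\1_(window a) x * F (u x))| <=
  4 * L * \int[mu]_x (u (stretch a s x) - u x) ^+ 2 +
  s * L * (eta * \int[mu]_x (u x ^+ 2) +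
       eta^-1 * \int[mu]_x (u (stretch a s x) - u x) ^+ 2).
Proof.
move=> L0 mf mF fL FL FfL a0 s01 eta0 uH; have /andP[s0 s1] := s01.
have uPH := Hhalf_stretch a0 s01 uH.
have uQH := Hhalf_unstretch a0 s01 uH.
have /HhalfP[mfu u2 _] := uH.
have /HhalfP[muP uP2 _] := uPH; have /HhalfP[muQ uQ2 _] := uQH.
have mfu_ : measurable_fun setT (f \o u) by exact: measurableT_comp.
have fu2 : mu.-integrable setT (EFin \o (fun x => (f \o u) x ^+ 2)).
  apply: integrable_dominated (integrable_scale (L ^+ 2) u2); first exact:
    measurable_funX.
  move=> x; rewrite ger0_norm ?sqr_ge0// -exprMn /= -ler_sqrt ?sqr_ge0//.
  by rewrite !sqrtr_sqr normrM (ger0_norm L0).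
have Fu : mu.-integrable setT (EFin \o (F \o u)).
  apply: integrable_dominated (integrable_scale L u2); first exact:
    measurableT_comp.
  by move=> x; exact: FL.
have mw : measurable (window a : set (measurableTypeR R)).
  exact: measurable_window.
have i1 := integrable_mulr mfu_ muP fu2 uP2.
have i2 := integrable_mulr mfu_ muQ fu2 uQ2.
have [i3 ->] := integral_mul_unstretch a0 s0 i2.
have i4 := integrable_indicM mw Fu.
have i5 := integrable_diff_stretch a0 s01 uH.
have i6 := integrable_mulr mfu_ mfu fu2 u2.
have [i7 e7] := integrable_stretch a0 s0 i6.
have [i8 e8] := integrable_stretch a0 s0 Fu.
(* Two zeros are added, both by the change of variables. They complete the integrand to the
   trapezoid expression in p = u and q = u o Phi. *)
have -> : forall A B C : R, A - B + C = A - B + C +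
  (\int[mu]_x ((f \o u) (stretch a s x) * u (stretch a s x) * stretch_deriv a s
    x)
   - \int[mu]_x ((f \o u) x * u x)) +
  2 * (\int[mu]_x (F \o u) x -
    \int[mu]_x ((F \o u) (stretch a s x) * stretch_deriv a s x)).
  by move=> A B C; rewrite e7 e8 !subrr mulr0 !addr0.
have i13 := integrable_sub i1 i3.
have i4' := integrable_scale (2 * s) i4.
have i76 := integrable_sub i7 i6.
have i8' := integrable_scale 2 (integrable_sub Fu i8).
have i134 := integrable_add i13 i4'.
have i13476 := integrable_add i134 i76.
set bound := leRHS.
rewrite -!RintegralB// -!RintegralZl//; last exact: integrable_sub.
rewrite -!RintegralD//.
set G := fun x => 4 * L * (u (stretch a s x) - u x) ^+ 2 +
  s * L * (eta * (u \o stretch a s) x ^+ 2 +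
    eta^-1 * (u (stretch a s x) - u x) ^+ 2).
have iG1 : mu.-integrable setT (EFin \o (fun x =>
   eta * (u \o stretch a s) x ^+ 2 + eta^-1 * (u (stretch a s x) - u x) ^+ 2)).
  by apply: integrable_add; exact: integrable_scale.
have iG : mu.-integrable setT (EFin \o G).
  by apply: integrable_add; exact: integrable_scale.
set H := fun x => _ + _.
have iH : mu.-integrable setT (EFin \o H) by exact: integrable_add.
have HG x : `|H x| <= G x.
  rewrite /H /G stretch_derivE /=.
  set p := u x; set q := u (stretch a s x); set d := \1_(window a) x.
  have dE : 0 <= d <= 1 by rewrite /d indicE; case: (_ \in _); rewrite /= ?lexx
    ?ler01.
  have h1 := FfL p q; have h2 := FfL q p.
  have h3 : `|f q * (q - p)| <= L * (eta * q ^+ 2 + eta^-1 * (q - p) ^+ 2).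
    apply: le_trans (ler_wpM2l L0 (ler_norm_mul q (q - p) eta0)).
    by rewrite !normrM mulrA ler_wpM2r.
  (* Taylor remainders at the two endpoints, plus a contribution of Phi' - 1 = s d. Only
     [f q * (q - p)] in the latter is of first order in q - p, and it carries the factor s. *)
  rewrite [X in `|X| <= _](_ : _ = - (F q - F p - f p * (q - p)) + (F p - F q -
    f q * (p - q)) +
    s * d * (2 * (F p - F q - f q * (p - q)) - f q * (q - p))); last by ring.
  have sqE : (p - q) ^+ 2 = (q - p) ^+ 2 by ring.
  rewrite sqE in h2.
  have sd : 0 <= s * d <= s.
    by move/andP: dE => [d0 d1]; rewrite mulr_ge0//= ler_piMr.
  have W0 : 0 <= L * (q - p) ^+ 2 by rewrite mulr_ge0 ?sqr_ge0.
  have h4 : `|- (F q - F p - f p * (q - p)) + (F p - F q - f q * (p - q))| <=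
      2 * (L * (q - p) ^+ 2).
    apply: (le_trans (ler_normD _ _)); rewrite normrN mulr_natl mulr2n.
    exact: lerD.
  have h5 : `|2 * (F p - F q - f q * (p - q)) - f q * (q - p)| <=
      2 * (L * (q - p) ^+ 2) + L * (eta * q ^+ 2 + eta^-1 * (q - p) ^+ 2).
    apply: (le_trans (ler_normB _ _)); rewrite lerD// normrM ger0_norm//.
    by rewrite ler_wpM2l.
  apply: (le_trans (ler_normD _ _)).
  rewrite [X in _ + X <= _]normrM.
  have /andP[sd0 sd1] := sd; rewrite (ger0_norm sd0).
  have h6 := ler_pM sd0 (normr_ge0 _) sd1 h5.
  have h7 : s * (2 * (L * (q - p) ^+ 2)) <= 2 * (L * (q - p) ^+ 2).
    by rewrite ler_piMl// mulr_ge0.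
  apply: (le_trans (lerD h4 h6)).
  rewrite (mulrDr s) -!mulrA; clear -h7; lra.
apply: (le_trans (le_normr_Rintegral measurableT iH)).
apply: (@le_trans _ _ (\int[mu]_x G x)).
  by apply: le_Rintegral => //; exact: integrable_norm.
have j1 := integrable_scale (4 * L) i5.
have j2 := integrable_scale (s * L) iG1.
have j3 := integrable_scale eta uP2.
have j4 := integrable_scale eta^-1 i5.
rewrite /G (RintegralD measurableT j1 j2) (RintegralZl _ measurableT i5).
rewrite (RintegralZl _ measurableT iG1) (RintegralD measurableT j3 j4).
rewrite (RintegralZl _ measurableT uP2) (RintegralZl _ measurableT i5).
rewrite /bound lerD// ler_wpM2l ?mulr_ge0// lerD// ler_wpM2l ?(ltW eta0)//.
exact: integral_stretch_sqr_le.
Qed.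

End defects.

(** * The dilation identity and its limit *)

Section pohozaev.
Context {R : realType}.
Notation mu := (@lebesgue_measure R).
Notation mu2 := (mu \x mu)%E.
Implicit Types (u v : R -> R) (a s eta : R).

Lemma near_diagonal_vanishing u : Hhalf u ->
  \int[mu2]_z (gagliardo u z * \1_(near_diagonal n.+1%:R^-1) z) @[n --> \oo]
    --> (0 : R).
Proof.
move=> /HhalfP[_ _ iu]; apply: Rintegral_vanishing => //.
  by move=> n; exact: measurable_near_diagonal.
move=> z gz0.
have z0 : 0 < `|z.1 - z.2|.
  rewrite normr_gt0; apply: contra gz0 => /eqP z0.
  by rewrite /gagliardo z0 normr0 expr0n invr0 mulr0.
near=> n; rewrite /near_diagonal/=; apply/negP; rewrite -ltNge.
by near: n; exact: near_infty_natSinv_lt (PosNum z0).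
Unshelve. all: by end_near. Qed.

(** One step [s] has to serve both functions, since both equations are tested with the same Phi. *)
Lemma stretch_modulus_small u v a eps : Hhalf u -> Hhalf v -> 0 < a ->
  0 < eps -> exists s, [/\ 0 < s <= 1,
    \int[mu]_x (u (stretch a s x) - u x) ^+ 2 <= s * eps &
    \int[mu]_x (v (stretch a s x) - v x) ^+ 2 <= s * eps].
Proof.
move=> uH vH a0 e0.
have d0 : 0 < eps / (5 * a) by rewrite divr_gt0// mulr_gt0.
have /cvgrPdist_le/(_ _ d0) nu := near_diagonal_vanishing uH.
have /cvgrPdist_le/(_ _ d0) nv := near_diagonal_vanishing vH.
near \oo => n.
have hu : `|0 - \int[mu2]_z (gagliardo u z * \1_(near_diagonal n.+1%:R^-1) z)|
  <=
  eps / (5 * a) by near: n.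
have hv : `|0 - \int[mu2]_z (gagliardo v z * \1_(near_diagonal n.+1%:R^-1) z)|
  <=
  eps / (5 * a) by near: n.
have n0 : 0 < n.+1%:R :> R by rewrite ltr0n.
(* This keeps 2 s a within the strip of width 1 / (n + 1), where the energy is at most eps / (5 a);
   that offsets the factor 5 s a of [stretch_modulus]. *)
pose s := Num.min 1 (2 * a * n.+1%:R)^-1.
have s0 : 0 < s by rewrite lt_min ltr01 invr_gt0 !mulr_gt0.
have s1 : s <= 1 by rewrite ge_min lexx.
have sr : 2 * (s * a) <= n.+1%:R^-1.
  have : s <= (2 * a * n.+1%:R)^-1 by rewrite ge_min lexx orbT.
  rewrite -(ler_pM2l (_ : 0 < 2 * a)) ?mulr_gt0// => h.
  rewrite (_ : 2 * (s * a) = 2 * a * s); last by ring.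
  apply: le_trans h _; rewrite le_eqVlt; apply/orP; left; apply/eqP; field.
  by rewrite !gt_eqF.
have s01 : 0 < s <= 1 by rewrite s0.
exists s; split => //.
- apply: le_trans (stretch_modulus uH a0 s01 sr) _.
  move: hu; rewrite sub0r normrN => /(le_trans (ler_norm _)).
  rewrite ler_pdivlMr ?mulr_gt0// => h.
  rewrite -(ler_pM2l s0) in h; apply: le_trans h.
  by rewrite le_eqVlt; apply/orP; left; apply/eqP; ring.
- apply: le_trans (stretch_modulus vH a0 s01 sr) _.
  move: hv; rewrite sub0r normrN => /(le_trans (ler_norm _)).
  rewrite ler_pdivlMr ?mulr_gt0// => h.
  rewrite -(ler_pM2l s0) in h; apply: le_trans h.
  by rewrite le_eqVlt; apply/orP; left; apply/eqP; ring.
Unshelve. all: by end_near. Qed.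

Lemma bilB u v v' : Hhalf u -> Hhalf v -> Hhalf v' ->
  \int[mu2]_z bil u (fun x => v x - v' x) z =
  \int[mu2]_z bil u v z - \int[mu2]_z bil u v' z.
Proof.
move=> uH vH vH'.
rewrite -(RintegralB measurableT (integrable_bilinear uH vH)
  (integrable_bilinear uH vH')).
by apply: eq_Rintegral => z _; rewrite /bil; ring.
Qed.

Lemma bilC u v z : bil u v z = bil v u z.
Proof. by rewrite /bil mulrC [X in _ * X]mulrC mulrC. Qed.

Lemma mulB_Rintegral (h v v' : R -> R) :
  mu.-integrable setT (EFin \o (fun x => h x * v x)) ->
  mu.-integrable setT (EFin \o (fun x => h x * v' x)) ->
  \int[mu]_x (h x * (v x - v' x)) =
  \int[mu]_x (h x * v x) - \int[mu]_x (h x * v' x).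
Proof.
move=> i1 i2; rewrite -(RintegralB measurableT i1 i2).
by apply: eq_Rintegral => z _; rewrite mulrBr.
Qed.

Definition tail u v a : R :=
  \int[mu2]_z (\1_(outside a) z * gagliardo u z) +
  \int[mu2]_z (\1_(outside a) z * gagliardo v z).

(* The last clause makes [F] a primitive of an [L]-Lipschitz [f]. *)
Definition lipschitz_pair (L : R) (f F : R -> R) :=
  [/\ measurable_fun setT f, measurable_fun setT F,
    (forall t, `|f t| <= L * `|t|), (forall t, `|F t| <= L * t ^+ 2) &
    (forall p q, `|F q - F p - f p * (q - p)| <= L * (q - p) ^+ 2)].

Lemma integrable_comp_sqr (L : R) (f : R -> R) u : 0 <= L ->
  measurable_fun setT f ->
  (forall t, `|f t| <= L * `|t|) -> Hhalf u ->
  measurable_fun setT (f \o u) /\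
  mu.-integrable setT (EFin \o (fun x => (f \o u) x ^+ 2)).
Proof.
move=> L0 mf fL /HhalfP[mfu u2 _].
have mfu_ : measurable_fun setT (f \o u) by exact: measurableT_comp.
split => //.
apply: integrable_dominated (integrable_scale (L ^+ 2) u2); first exact:
  measurable_funX.
move=> x; rewrite ger0_norm ?sqr_ge0// -exprMn /= -ler_sqrt ?sqr_ge0//.
by rewrite !sqrtr_sqr normrM (ger0_norm L0).
Qed.

(** The weak equation tested with [uP - uQ] and [vP - vQ], without estimates. The kinetic terms are
    arranged for [kinetic_defect], which compares a term of one equation with a term of the
    other. *)
Lemma dilation_identity (V0 : R) (f g : R -> R) u v (L : R) (F G : R -> R) a s :
  0 <= L -> lipschitz_pair L f F -> lipschitz_pair L g G ->
  weak_solution V0 f g u v -> 0 <= a -> 0 <= s <= 1 ->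
  let uP := u \o stretch a s in let uQ := u \o unstretch a s in
  let vP := v \o stretch a s in let vQ := v \o unstretch a s in
  (2 * pi)^-1 * (\int[mu2]_z bil vP u z - \int[mu2]_z bil u vQ z) +
  V0 * (\int[mu]_x (u x * vP x) - \int[mu]_x (u x * vQ x)) +
  ((2 * pi)^-1 * (\int[mu2]_z bil uP v z - \int[mu2]_z bil v uQ z) +
  V0 * (\int[mu]_x (v x * uP x) - \int[mu]_x (v x * uQ x))) =
  (\int[mu]_x ((f \o u) x * uP x) - \int[mu]_x ((f \o u) x * uQ x)) +
  (\int[mu]_x ((g \o v) x * vP x) - \int[mu]_x ((g \o v) x * vQ x)).
Proof.
move=> L0 [mf _ fL _ _] [mg _ gL _ _] [uH vH weak] a0 s01 uP uQ vP vQ.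
have uPH : Hhalf uP by exact: Hhalf_stretch.
have uQH : Hhalf uQ by exact: Hhalf_unstretch.
have vPH : Hhalf vP by exact: Hhalf_stretch.
have vQH : Hhalf vQ by exact: Hhalf_unstretch.
have /HhalfP[mu_ u2 _] := uH; have /HhalfP[mv v2 _] := vH.
have /HhalfP[muP uP2 _] := uPH; have /HhalfP[mvP vP2 _] := vPH.
have /HhalfP[muQ uQ2 _] := uQH; have /HhalfP[mvQ vQ2 _] := vQH.
have [mfu fu2] := integrable_comp_sqr L0 mf fL uH.
have [mgv gv2] := integrable_comp_sqr L0 mg gL vH.
have := weak _ _ (HhalfB uPH uQH) (HhalfB vPH vQH).
have i1 := integrable_mulr mfu muP fu2 uP2.
have i2 := integrable_mulr mfu muQ fu2 uQ2.
have i3 := integrable_mulr mgv mvP gv2 vP2.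
have i4 := integrable_mulr mgv mvQ gv2 vQ2.
have i12 : mu.-integrable setT (EFin \o (fun x => (f \o u) x * (uP x - uQ x))).
  rewrite (_ : (fun x => _) = (fun x => (f \o u) x * uP x - (f \o u) x * uQ x)).
    exact: integrable_sub.
  by apply/funext => x; rewrite mulrBr.
have i34 : mu.-integrable setT (EFin \o (fun x => (g \o v) x * (vP x - vQ x))).
  rewrite (_ : (fun x => _) = (fun x => (g \o v) x * vP x - (g \o v) x * vQ x)).
    exact: integrable_sub.
  by apply/funext => x; rewrite mulrBr.
rewrite -(EFin_Rintegral (integrable_add i12 i34)) => -[].
rewrite (RintegralD measurableT i12 i34) !mulB_Rintegral// => <-.
rewrite /half_form -/(bil _ _) (bilB uH vPH vQH) (bilB vH uPH uQH).
rewrite !mulB_Rintegral//; try exact: integrable_mulr.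
by do 2 (congr (_ + _)); congr (_ * (_ - _)); apply: eq_Rintegral => z _;
  rewrite bilC.
Qed.

End pohozaev.

Section pohozaev_lipschitz.
Context {R : realType}.
Notation mu := (@lebesgue_measure R).
Notation mu2 := (mu \x mu)%E.
Implicit Types (u v : R -> R) (a s eta : R).

(** All defects are of order s, so s has been divided out. What matters is that [C] depends neither
    on [a] nor on [eta]. *)
Lemma pohozaev_window (V0 : R) (f g : R -> R) u v (L : R) (F G : R -> R) :
  0 <= V0 -> 0 <= L -> lipschitz_pair L f F -> lipschitz_pair L g G ->
  weak_solution V0 f g u v ->
  exists C : R, forall a eta, 0 < a -> 0 < eta <= 1 ->
    `|\int[mu]_x (\1_(window a) x * F (u x)) +
      \int[mu]_x (\1_(window a) x * G (v x)) -
      V0 * \int[mu]_x (\1_(window a) x * (u x * v x))| <=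
    C * eta + 3 * eta^-1 * tail u v a.
Proof.
move=> V00 L0 fF gG ws.
have [uH vH _] := ws.
set U := \int[mu]_x (u x ^+ 2); set V := \int[mu]_x (v x ^+ 2).
set Gu := \int[mu2]_z gagliardo u z; set Gv := \int[mu2]_z gagliardo v z.
exists (12 * (Gu + Gv) + V0 * (U + V + 2) + L * (U + V + 10)).
move=> a eta a0 /andP[eta0 eta1].
(* The accuracy [eta ^+ 2] makes the terms weighted by [eta^-1] at most s eta. *)
have [s [/andP[s0 s1] mus mvs]] := stretch_modulus_small uH vH a0 (exprn_gt0 2
  eta0).
have s01 : 0 <= s <= 1 by rewrite ltW.
have a0' := ltW a0.
set mu_ := \int[mu]_x (u (stretch a s x) - u x) ^+ 2 in mus.
set mv := \int[mu]_x (v (stretch a s x) - v x) ^+ 2 in mvs.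
have := dilation_identity L0 fF gG ws a0' s01; cbv zeta.
have k1 := kinetic_defect a0' s01 eta0 uH vH.
have k2 := kinetic_defect a0' s01 eta0 vH uH.
have c1 := cross_defect a0' s01 eta0 uH vH.
have c2 := cross_defect a0' s01 eta0 vH uH.
have [mf mF fL FL FfL] := fF.
have [mg mG gL GL GgL] := gG.
have n1 := nonlinear_defect L0 mf mF fL FL FfL a0' s01 eta0 uH.
have n2 := nonlinear_defect L0 mg mG gL GL GgL a0' s01 eta0 vH.
rewrite -/U -/V -/Gu -/Gv -/mu_ -/mv in k1 k2 c1 c2 n1 n2.
rewrite /tail; set Tu := \int[mu2]_z (\1_(outside a) z * gagliardo u z) in k2 *.
set Tv := \int[mu2]_z (\1_(outside a) z * gagliardo v z) in k1 *.
have symm : \int[mu]_x (\1_(window a) x * (v x * u x)) =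
    \int[mu]_x (\1_(window a) x * (u x * v x)).
  by apply: eq_Rintegral => x _; rewrite [v x * u x]mulrC.
rewrite symm in c2.
have U0 : 0 <= U by apply: Rintegral_ge0 => x _; exact: sqr_ge0.
have V0' : 0 <= V by apply: Rintegral_ge0 => x _; exact: sqr_ge0.
have Gu0 : 0 <= Gu by apply: Rintegral_ge0 => x _; exact: gagliardo_ge0.
have Gv0 : 0 <= Gv by apply: Rintegral_ge0 => x _; exact: gagliardo_ge0.
have T0 w : 0 <= \int[mu2]_z (\1_(outside a) z * gagliardo w z).
  by apply: Rintegral_ge0 => z _; rewrite mulr_ge0// gagliardo_ge0.
have Tu0 : 0 <= Tu by exact: T0.
have Tv0 : 0 <= Tv by exact: T0.
move: k1 k2 c1 c2 n1 n2.
set K1 := \int[mu2]_z bil u (v \o unstretch a s) z.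
set K2 := \int[mu2]_z bil (u \o stretch a s) v z.
set K3 := \int[mu2]_z bil v (u \o unstretch a s) z.
set K4 := \int[mu2]_z bil (v \o stretch a s) u z.
set C1 := \int[mu]_x (u x * (v \o stretch a s) x).
set C2 := \int[mu]_x (v x * (u \o unstretch a s) x).
set C3 := \int[mu]_x (v x * (u \o stretch a s) x).
set C4 := \int[mu]_x (u x * (v \o unstretch a s) x).
set N1 := \int[mu]_x ((f \o u) x * (u \o stretch a s) x).
set N2 := \int[mu]_x ((f \o u) x * (u \o unstretch a s) x).
set N3 := \int[mu]_x ((g \o v) x * (v \o stretch a s) x).
set N4 := \int[mu]_x ((g \o v) x * (v \o unstretch a s) x).
set W := \int[mu]_x (\1_(window a) x * (u x * v x)).
set WF := \int[mu]_x (\1_(window a) x * F (u x)).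
set WG := \int[mu]_x (\1_(window a) x * G (v x)).
have eu : eta^-1 * mu_ <= s * eta.
  rewrite -(ler_pM2l eta0) mulrA divff ?mul1r ?gt_eqF//.
  by apply: (le_trans mus); rewrite le_eqVlt; apply/orP; left; apply/eqP; ring.
have evv : eta^-1 * mv <= s * eta.
  rewrite -(ler_pM2l eta0) mulrA divff ?mul1r ?gt_eqF//.
  by apply: (le_trans mvs); rewrite le_eqVlt; apply/orP; left; apply/eqP; ring.
have seta : s * eta <= eta by rewrite ler_piMl// ltW.
have eta2 : eta ^+ 2 <= eta by rewrite expr2 ler_piMr// ltW.
have mueta : mu_ <= s * eta by apply: (le_trans mus); rewrite ler_pM2l.
have mveta : mv <= s * eta by apply: (le_trans mvs); rewrite ler_pM2l.
clearbody K1 K2 K3 K4 C1 C2 C3 C4 N1 N2 N3 N4 W WF WG mu_ mv U V Gu Gv Tu Tv.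
clear -V00 L0 s0 s1 eta0 eta1 eu evv seta mueta mveta U0 V0' Gu0 Gv0 Tu0 Tv0.
move=> k1 k2 c1 c2 n1 n2 e.
have pi1 : 2 * pi >= 1 :> R by have := pi_ge2 R; lra.
have ipi : 0 <= (2 * pi : R)^-1 <= 1.
  by rewrite invr_ge0 (le_trans ler01)//= invf_le1// (lt_le_trans ltr01).
move: e; move: ((2 * pi)^-1) ipi => p /andP[p0 p1] e.
set X1 := K1 - K2 in k1; set X2 := K3 - K4 in k2.
set Y1 := C1 - C2 + s * W in c1; set Y2 := C3 - C4 + s * W in c2.
set Z1 := N1 - N2 + 2 * s * WF in n1; set Z2 := N3 - N4 + 2 * s * WG in n2.
(* The identity [e] regrouped into defects: each pair contains one term from either equation in
   [X1], [X2], [Y1], [Y2], and both terms from the same one in [Z1], [Z2]. *)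
have main : 2 * s * (WF + WG - V0 * W) =
   Z1 + Z2 + p * (X1 + X2) - V0 * (Y1 + Y2).
  rewrite /Z1 /Z2 /X1 /X2 /Y1 /Y2; move: e; clear; lra.
have hY1 : `|Y1| <= s * (eta * (U + 1)).
  have q : s * (eta^-1 * mv) <= s * eta.
    by rewrite ler_pM2l//; exact: le_trans evv seta.
  by apply: (le_trans c1); clear -q; lra.
have hY2 : `|Y2| <= s * (eta * (V + 1)).
  have q : s * (eta^-1 * mu_) <= s * eta.
    by rewrite ler_pM2l//; exact: le_trans eu seta.
  by apply: (le_trans c2); clear -q; lra.
have sL : 0 <= s * L by rewrite mulr_ge0// ltW.
have hZ1 : `|Z1| <= s * (eta * (L * (U + 5))).
  apply: (le_trans n1).
  have q1 := ler_wpM2l L0 mueta.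
  have q2 : s * L * (eta * U + eta^-1 * mu_) <= s * L * (eta * U + eta).
    by rewrite ler_wpM2l// lerD2l; exact: le_trans eu seta.
  clear -q1 q2; lra.
have hZ2 : `|Z2| <= s * (eta * (L * (V + 5))).
  apply: (le_trans n2).
  have q1 := ler_wpM2l L0 mveta.
  have q2 : s * L * (eta * V + eta^-1 * mv) <= s * L * (eta * V + eta).
    by rewrite ler_wpM2l// lerD2l; exact: le_trans evv seta.
  clear -q1 q2; lra.
have hX : `|p * (X1 + X2)| <=
    s * (12 * eta * (Gu + Gv) + 3 * eta^-1 * (Tu + Tv)).
  rewrite normrM (ger0_norm p0).
  apply: (@le_trans _ _ (1 * `|X1 + X2|)); first by rewrite ler_wpM2r.
  by rewrite mul1r; apply: (le_trans (ler_normD _ _)); clear -k1 k2; lra.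
have hY : `|V0 * (Y1 + Y2)| <= V0 * (s * (eta * (U + V + 2))).
  rewrite normrM (ger0_norm V00) ler_wpM2l//.
  by apply: (le_trans (ler_normD _ _)); clear -hY1 hY2; lra.
have h : `|2 * s * (WF + WG - V0 * W)| <=
    s * (eta * (L * (U + 5))) + s * (eta * (L * (V + 5))) +
    s * (12 * eta * (Gu + Gv) + 3 * eta^-1 * (Tu + Tv)) +
    V0 * (s * (eta * (U + V + 2))).
  rewrite main; apply: (le_trans (ler_normB _ _)); apply: lerD hY.
  apply: (le_trans (ler_normD _ _)); apply: lerD hX.
  by apply: (le_trans (ler_normD _ _)); apply: lerD.
rewrite normrM ger0_norm in h; last by rewrite mulr_ge0// ltW.
set A := `|_| in h *.
have A0 : 0 <= A by exact: normr_ge0.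
rewrite -(ler_pM2l s0).
have sA : 0 <= s * A by rewrite mulr_ge0// ltW.
clear -h sA; lra.
Qed.

End pohozaev_lipschitz.

Section pohozaev_lipschitz.
Context {R : realType}.
Notation mu := (@lebesgue_measure R).
Notation mu2 := (mu \x mu)%E.
Implicit Types (u v : R -> R) (a s eta : R).

Lemma pohozaev_lipschitz (V0 : R) (f g : R -> R) u v (L : R) (F G : R -> R) :
  0 <= V0 -> 0 <= L -> lipschitz_pair L f F -> lipschitz_pair L g G ->
  weak_solution V0 f g u v ->
  mu.-integrable setT (EFin \o (fun x => F (u x) + G (v x) - V0 * u x * v x)) /\
  \int[mu]_x (F (u x) + G (v x) - V0 * u x * v x) = 0.
Proof.
move=> V00 L0 fF gG ws.
have [C hC] := pohozaev_window V00 L0 fF gG ws.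
have [uH vH _] := ws.
have [_ mF _ FL _] := fF; have [_ mG _ GL _] := gG.
have /HhalfP[mfu u2 iu] := uH; have /HhalfP[mfv v2 iv] := vH.
have iF : mu.-integrable setT (EFin \o (F \o u)).
  apply: integrable_dominated (integrable_scale L u2); first exact:
    measurableT_comp.
  by move=> x; exact: FL.
have iG : mu.-integrable setT (EFin \o (G \o v)).
  apply: integrable_dominated (integrable_scale L v2); first exact:
    measurableT_comp.
  by move=> x; exact: GL.
have iuv := integrable_mulr mfu mfv u2 v2.
have iVuv := integrable_scale V0 iuv.
set H := fun x => _.
have iH : mu.-integrable setT (EFin \o H).
  rewrite (_ : H = (fun x => (F \o u) x + (G \o v) x - V0 * (u x * v x))).
    by apply: integrable_sub => //; exact: integrable_add.
  by apply/funext => x; rewrite /H mulrA.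
split => //.
have mw a : measurable (window a : set (measurableTypeR R)).
  exact: measurable_window.
have mwC n : measurable (~` window n%:R : set (measurableTypeR R)).
  by apply: measurableC; exact: mw.
have mo n : measurable (outside n%:R : set (measurableTypeR R * measurableTypeR
  R)).
  exact: measurable_outside.
have in_window (x : R) : \forall n \near \oo, window n%:R x.
  near=> n; have xn : `|x| < n%:R.
    by near: n; exact: nbhs_infty_gtr.
  by move: xn; rewrite /window/= in_itv/= ltr_norml => /andP[-> /ltW].
have in_outside (z : R * R) : \forall n \near \oo, ~ outside n%:R z.
  near=> n.
  have h1 : window n%:R z.1 by near: n; exact: in_window.
  have h2 : window n%:R z.2 by near: n; exact: in_window.
  by apply.
have in_windowC (x : R) : \forall n \near \oo, ~ (~` window n%:R) x.
  near=> n; have h : window n%:R x by near: n; exact: in_window.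
  by apply.
have tH := Rintegral_vanishing iH mwC (fun x _ => in_windowC x).
have tu := Rintegral_vanishing iu mo (fun z _ => in_outside z).
have tv := Rintegral_vanishing iv mo (fun z _ => in_outside z).
(* With [a = n] so large that the tail is at most 2 eta^2, the term 3 eta^-1 tail is at most 6 eta;
   the last 1 pays for the integral of [H] off the window. *)
have bound eta : 0 < eta <= 1 -> `|\int[mu]_x H x| <= (C + 3 * 2 + 1) * eta.
  move=> eta01; have /andP[eta0 eta1] := eta01.
  rewrite (_ : _ * eta = C * eta + 3 * 2 * eta + eta); last by ring.
  have e3 : 3 * eta^-1 * (2 * eta ^+ 2) = 3 * 2 * eta by field; rewrite gt_eqF.
  have e2 : 0 < eta ^+ 2 by rewrite exprn_gt0.
  move/cvgrPdist_le : (tH) => /(_ _ eta0) nH.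
  move/cvgrPdist_le : (tu) => /(_ _ e2) nu.
  move/cvgrPdist_le : (tv) => /(_ _ e2) nv.
  near \oo => n.
  have n0 : 0 < n%:R :> R by rewrite ltr0n; near: n; exact: nbhs_infty_gt.
  have hH : `|0 - \int[mu]_x (H x * \1_(~` window n%:R) x)| <= eta by near: n.
  have hu : `|0 - \int[mu2]_z (gagliardo u z * \1_(outside n%:R) z)| <= eta ^+
    2.
    by near: n.
  have hv : `|0 - \int[mu2]_z (gagliardo v z * \1_(outside n%:R) z)| <= eta ^+
    2.
    by near: n.
  have tl : tail u v n%:R <= 2 * eta ^+ 2.
    have eqo w : \int[mu2]_z (\1_(outside n%:R) z * gagliardo w z) =
        \int[mu2]_z (gagliardo w z * \1_(outside n%:R) z).
      by apply: eq_Rintegral => z _; rewrite mulrC.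
    rewrite /tail !eqo.
    move: hu hv; rewrite !sub0r !normrN => /(le_trans (ler_norm _)) h1.
    by move=> /(le_trans (ler_norm _)) h2; rewrite mulr_natl mulr2n; exact:
      lerD.
  have hw := hC _ _ n0 eta01.
  have split_H : \int[mu]_x H x =
    (\int[mu]_x (\1_(window n%:R) x * F (u x)) +
      \int[mu]_x (\1_(window n%:R) x * G (v x)) -
      V0 * \int[mu]_x (\1_(window n%:R) x * (u x * v x))) +
    \int[mu]_x (H x * \1_(~` window n%:R) x).
    have j1 := integrable_indicM (mw n%:R) iF.
    have j2 := integrable_indicM (mw n%:R) iG.
    have j3 := integrable_indicM (mw n%:R) iuv.
    have j4 : mu.-integrable setT (EFin \o (fun x => H x * \1_(~` window n%:R)
      x)).
      rewrite (_ : (fun x => _) = (fun x => \1_(~` window n%:R) x * H x)).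
        exact: integrable_indicM.
      by apply/funext => x; rewrite mulrC.
    have j3' := integrable_scale V0 j3.
    have j12 := integrable_add j1 j2.
    have j123 := integrable_sub j12 j3'.
    rewrite -(RintegralZl _ measurableT j3) -(RintegralD measurableT j1 j2).
    rewrite -(RintegralB measurableT j12 j3') -(RintegralD measurableT j123 j4).
    apply: eq_Rintegral => x _; rewrite /H /= !indicE in_setC.
    by case: (_ \in _); rewrite /= ?mulr1n ?mulr0n; ring.
  rewrite split_H; apply: (le_trans (ler_normD _ _)).
  move: hH; rewrite sub0r normrN => hH.
  apply: lerD hH; apply: (le_trans hw); rewrite lerD2l -e3.
  by rewrite ler_wpM2l// mulr_ge0// invr_ge0 ltW.
apply/eqP; rewrite -normr_le0; apply/ler_addgt0Pr => e e0.
pose D := `|C + 3 * 2 + 1| + 1.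
have D1 : 1 <= D by rewrite /D lerDr.
have D0 : 0 < D by lra.
pose eta := Num.min 1 (e / D).
have eta01 : 0 < eta <= 1.
  by rewrite /eta lt_min ltr01 divr_gt0//= ge_min lexx.
apply: (le_trans (bound _ eta01)); rewrite add0r.
have h1 : eta <= e / D by rewrite /eta ge_min lexx orbT.
have /andP[eta0 _] := eta01.
apply: (@le_trans _ _ (D * eta)).
  rewrite ler_pM2r// /D (le_trans (ler_norm _))// lerDl//.
by rewrite -ler_pdivlMl// mulrC.
Unshelve. all: by end_near. Qed.

End pohozaev_lipschitz.

(** * Reduction to Lipschitz nonlinearities *)

Section nonlinearity.
Context {R : realType}.
Notation mu := (@lebesgue_measure R).
Implicit Types (f h : R -> R) (B t p q : R).

(** The hypothesis is local around points of the plane, so compactness of the square [-B, B]^2 gives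
    one constant for all pairs, distant ones included. *)
Lemma locally_lipschitz_itv f B :
  [locally [lipschitz f x | x in [set: R]]] ->
  exists2 L : R, 0 <= L & forall p q, p \in `[- B, B] -> q \in `[- B, B] ->
    `|f p - f q| <= L * `|p - q|.
Proof.
move=> lip.
pose K : set (R * R) := `[- B, B]%classic `*` `[- B, B]%classic.
have cK : compact K by apply: compact_setX; exact: segment_compact.
move/compact_near_coveringP : cK => cK.
have : \forall M \near +oo, K `<=` [set z | `|f z.1 - f z.2| <= M * `|z.1 -
  z.2|].
  apply: (cK R (+oo) (fun M z => `|f z.1 - f z.2| <= M * `|z.1 - z.2|)) => z Kz.
  have nearM := lip z (conj I I).
  have [M nz] : exists M : R, \forall w \near z,
      `|f w.1 - f w.2| <= M * `|w.1 - w.2|.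
    near (pinfty_nbhs R) => M; exists M.
    have : M.-lipschitz_on f (within ([set: R] `*` [set: R]) (nbhs z)).
      by near: M.
    move=> h; have : nbhs z (fun w => ([set: R] `*` [set: R]) w ->
      `|f w.1 - f w.2| <= M * `|w.1 - w.2|) by exact: h.
    by apply: filterS => w; apply.
  near=> w i => /=.
  apply: (@le_trans _ _ (M * `|w.1 - w.2|)); first by near: w.
  by rewrite ler_wpM2r//; near: i; exact: nbhs_pinfty_ge.
move=> hM; near (pinfty_nbhs R) => M.
exists M; first by near: M; exact: nbhs_pinfty_ge.
move=> p q pB qB.
have : K `<=` [set z | `|f z.1 - f z.2| <= M * `|z.1 - z.2|] by near: M.
by move=> /(_ (p, q)) /=; apply; split.
Unshelve. all: by end_near. Qed.

(** The filter [0^'] does not see 0 itself; continuity carries the limit over to the value. *)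
Lemma littleo_sqr_eq0 f : continuous f ->
  f =o_ (0^') (fun t : R => t ^+ 2) -> f 0 = 0.
Proof.
move=> cf fo; apply/eqP; rewrite -normr_le0; apply/ler_addgt0Pr => e e0.
have e2 : 0 < e / 2 by lra.
have /eqoP/(_ _ e2) h1 := fo.
have : \forall t \near 0^', `|f 0 - f t| <= e / 2.
  by apply: nbhs_dnbhs; move/cvgrPdist_le : (cf 0) => /(_ _ e2).
move=> h2.
near (0 : R)^' => t.
have f1 : `|f t| <= e / 2 * `|t ^+ 2| by near: t.
have f2 : `|f 0 - f t| <= e / 2 by near: t.
have t1 : `|t| <= 1.
  near: t; apply: nbhs_dnbhs.
  have /cvgrPdist_le/(_ _ ltr01) := @cvg_id _ (nbhs (0 : R)).
  by apply: filterS => t; rewrite sub0r normrN.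
rewrite add0r (_ : f 0 = (f 0 - f t) + f t); last by ring.
apply: (le_trans (ler_normD _ _)).
have : e / 2 * `|t ^+ 2| <= e / 2.
  have t2 : `|t ^+ 2| <= 1 by rewrite normrX exprn_ile1.
  by apply: ler_piMr t2; lra.
lra.
Unshelve. all: by end_near. Qed.

(** The limit gives the bound with constant 1 far out; on the remaining compact interval the maximum
    of |f| serves. *)
Lemma gaussian_growth f (beta : R) : continuous f -> 0 <= beta ->
  `|f t| * expR (- beta * t ^+ 2) @[t --> abs_infty R] --> (0 : R) ->
  exists2 c : R, 0 <= c & forall t, `|f t| <= c * expR (beta * t ^+ 2).
Proof.
move=> cf b0 /cvgrPdist_le/(_ _ ltr01) [M hM].
have MM : - `|M| <= `|M| by rewrite (le_trans _ (normr_ge0 M))// oppr_le0.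
have [c _ hc] : exists2 c, c \in `[- `|M|, `|M|] &
    forall t, t \in `[- `|M|, `|M|] -> `|f t| <= `|f c|.
  apply: EVT_max => //; apply: continuous_subspaceT => x.
  by apply: continuous_comp; [exact: cf|exact: norm_continuous].
exists (`|f c| + 1); first by rewrite addr_ge0.
move=> t; have [tM|Mt] := leP `|t| `|M|.
  have e1 : 1 <= expR (beta * t ^+ 2).
    by rewrite -expR0 ler_expR mulr_ge0// sqr_ge0.
  apply: (@le_trans _ _ (`|f c| + 1)).
    by rewrite (le_trans (hc t _)) ?lerDl// in_itv/= -ler_norml.
  by rewrite ler_peMr// addr_ge0.
have := hM t (le_lt_trans (ler_norm M) Mt).
rewrite sub0r normrN normrM normr_id (ger0_norm (expR_ge0 _)) mulNr expRN.
rewrite ler_pdivrMr ?expR_gt0// mul1r => /le_trans; apply.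
by rewrite ler_peMl ?expR_ge0// lerDr.
Qed.

Lemma Rintegral_chasles h a b c : continuous h -> a <= b -> b <= c ->
  \int[mu]_(x in `[a, c]) h x =
  \int[mu]_(x in `[a, b]) h x + \int[mu]_(x in `[b, c]) h x.
Proof.
move=> ch ab bc.
have ih (x y : R) : mu.-integrable `[x, y] (EFin \o h).
  apply: continuous_compact_integrable; first exact: segment_compact.
  exact: continuous_subspaceT.
have ioc : mu.-integrable `]b, c] (EFin \o h).
  by apply: integrableS (ih b c) => //; exact: subset_itv_oc_cc.
rewrite -(Rintegral_itv_obnd_cbnd ioc) -(Rintegral_itvB (ih a c) (x := b)).
- by ring.
- by rewrite bnd_simp.
- by rewrite bnd_simp.
Qed.

Lemma primitiveB h p q : continuous h -> p <= q ->
  primitive h q - primitive h p = \int[mu]_(x in `[p, q]) h x.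
Proof.
move=> ch pq; rewrite /primitive.
have [q0|q0] := leP 0 q; have [p0|p0] := leP 0 p.
- by rewrite (Rintegral_chasles ch p0 pq); ring.
- by rewrite (Rintegral_chasles ch (ltW p0) q0); ring.
- by lra.
- by rewrite (Rintegral_chasles ch pq (ltW q0)); ring.
Qed.

Lemma primitive_taylor h (L : R) p q : continuous h -> 0 <= L ->
  (forall x y, `|h x - h y| <= L * `|x - y|) ->
  `|primitive h q - primitive h p - h p * (q - p)| <= L * (q - p) ^+ 2.
Proof.
move=> ch L0 hL.
have ih (x y : R) : mu.-integrable `[x, y] (EFin \o h).
  apply: continuous_compact_integrable; first exact: segment_compact.
  exact: continuous_subspaceT.
have ic (k x y : R) : mu.-integrable `[x, y] (EFin \o (fun=> k)).
  apply: continuous_compact_integrable; first exact: segment_compact.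
  by apply: continuous_subspaceT => ?; exact: cvg_cst.
have cE (k x y : R) : x <= y -> \int[mu]_(_ in `[x, y]) k = k * (y - x).
  move=> xy; have e : mu `[x, y]%classic = (y - x)%:E.
    rewrite lebesgue_measure_itv/= lte_fin.
    by case: ltgtP xy => //= -> _; rewrite subrr.
  rewrite Rintegral_cst//; congr (_ * _).
  by rewrite -[RHS]/(fine (y - x)%:E) -e.
have key (x y r : R) : x <= y -> r \in `[x, y] ->
    `|\int[mu]_(t in `[x, y]) h t - h r * (y - x)| <= L * (y - x) ^+ 2.
  move=> xy rxy; rewrite -(cE (h r)) // -RintegralB//.
  have i1 : mu.-integrable `[x, y] (EFin \o (fun t => h t - h r)).
    exact: (integrableB _ (ih x y) (ic (h r) x y)).
  have mI : measurable (`[x, y]%classic : set (measurableTypeR R)).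
    exact: measurable_itv.
  apply: (le_trans (le_normr_Rintegral mI i1)).
  rewrite expr2 mulrA -(cE (L * (y - x)))//.
  apply: (le_Rintegral mI (integrable_norm i1) (ic _ _ _)).
  move=> t /=; rewrite in_itv/= => /andP[xt ty].
  apply: (le_trans (hL _ _)); rewrite ler_wpM2l// ler_norml.
  by move: rxy; rewrite in_itv/= => /andP[? ?]; apply/andP; split; lra.
have [pq|/ltW qp] := leP p q.
  by rewrite primitiveB//; apply: key => //; rewrite in_itv/= lexx.
rewrite -normrN [X in `|X| <= _](_ : _ =
  primitive h p - primitive h q - h p * (p - q)); last by ring.
rewrite primitiveB// (_ : (q - p) ^+ 2 = (p - q) ^+ 2); last by ring.
by apply: key => //; rewrite in_itv/= lexx qp.
Qed.

End nonlinearity.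

(** * Truncation of the nonlinearities and two-sided bounds *)

Section truncation.
Context {R : realType}.
Notation mu := (@lebesgue_measure R).
Notation mu2 := (mu \x mu)%E.
Implicit Types (f g h u v phi psi : R -> R) (B t : R).

Lemma clamp_itv B t : 0 <= B -> clamp B t \in `[- B, B].
Proof. by move=> B0; rewrite in_itv/= -ler_norml norm_clamp. Qed.

Lemma clamp_id B t : `|t| <= B -> clamp B t = t.
Proof.
rewrite ler_norml => /andP[h1 h2].
have B0 : 0 <= B by lra.
case: (clamp_cases t B0) => -[]; lra.
Qed.

Lemma clamp_dist B x y : 0 <= B -> `|clamp B x - clamp B y| <= `|x - y|.
Proof.
move=> B0; wlog yx : x y / y <= x.
  move=> W; have [|/ltW] := leP y x; first exact: W.
  by move=> xy; rewrite distrC [leRHS]distrC; exact: W.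
have /andP[h1 h2] := clampB B0 yx.
by rewrite !ger0_norm ?subr_ge0//; lra.
Qed.

Lemma continuous_clamp B : 0 <= B -> continuous (clamp B : R -> R).
Proof.
move=> B0 x; apply/cvgrPdist_le => e e0; near=> y.
apply: (le_trans (clamp_dist x y B0)).
by near: y; have /cvgrPdist_le/(_ _ e0) := @cvg_id _ (nbhs x).
Unshelve. all: by end_near. Qed.

(** Precomposing with [clamp B] makes [f] globally Lipschitz without changing it on [-B, B], the
    range of a bounded solution. *)
Lemma truncated_lipschitz_pair f B : continuous f -> f 0 = 0 ->
  [locally [lipschitz f x | x in [set: R]]] -> 0 <= B ->
  exists2 L : R, 0 <= L &
    lipschitz_pair L (f \o clamp B) (primitive (f \o clamp B)).
Proof.
move=> cf f0 lip B0; have [L L0 hL] := locally_lipschitz_itv B lip.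
exists L => //.
have ch : continuous (f \o clamp B).
  by move=> x; apply: continuous_comp; [exact: continuous_clamp|exact: cf].
have hlip x y : `|(f \o clamp B) x - (f \o clamp B) y| <= L * `|x - y|.
  apply: (le_trans (hL _ _ (clamp_itv _ B0) (clamp_itv _ B0))).
  by rewrite ler_wpM2l// clamp_dist.
have taylor p q := primitive_taylor p q ch L0 hlip.
have h00 : (f \o clamp B) 0 = 0 by rewrite /= clamp_id ?normr0.
have P0 : primitive (f \o clamp B) 0 = 0.
  by rewrite /primitive lexx set_itv1 Rintegral_set1.
have hle t : `|(f \o clamp B) t| <= L * `|t|.
  by have := hlip t 0; rewrite h00 !subr0.
have cP : continuous (primitive (f \o clamp B)).
  move=> p; apply/cvgrPdist_le => e e0.
  (* A Lipschitz constant at [p] for steps of length at most 1, read off the Taylor estimate; the 1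
     only keeps it positive. *)
  pose k := L * `|p| + L + 1.
  have k0 : 0 < k by rewrite ltr_wpDl// addr_ge0// mulr_ge0.
  have m0 : 0 < Num.min 1 (e / k) by rewrite lt_min ltr01 divr_gt0.
  near=> q.
  have : `|p - q| <= Num.min 1 (e / k).
    by near: q; have /cvgrPdist_le/(_ _ m0) := @cvg_id _ (nbhs p).
  rewrite le_min => /andP[q1 qe].
  have Lt : `|primitive (f \o clamp B) q - primitive (f \o clamp B) p| <= k *
    `|p - q|.
    have h1 := taylor p q.
    have h2 := ler_wpM2r (normr_ge0 (q - p)) (hle p).
    rewrite -normrM in h2.
    rewrite -[_ - _](subrK ((f \o clamp B) p * (q - p))).
    apply: (le_trans (ler_normD _ _)).
    apply: (le_trans (lerD h1 h2)).
    rewrite -[(q - p) ^+ 2]real_normK ?num_real// distrC.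
    have := normr_ge0 (p - q); have := normr_ge0 p.
    move: q1 L0; rewrite /k; clear; move: `|p - q| `|p| => d n d1 L0 n0 d0.
    have : L * d ^+ 2 <= L * d by rewrite ler_wpM2l// expr2 ler_piMr.
    nra.
  rewrite distrC; apply: (le_trans Lt).
  by rewrite -ler_pdivlMl// mulrC.
split => //.
- exact: continuous_measurable_fun.
- exact: continuous_measurable_fun.
- by move=> t; have := taylor 0 t; rewrite P0 h00 mul0r !subr0.
Unshelve. all: by end_near. Qed.

Lemma primitive_clamp f B t : `|t| <= B ->
  primitive (f \o clamp B) t = primitive f t.
Proof.
move=> tB; rewrite /primitive; have [t0|t0] := leP 0 t.
  apply: eq_Rintegral => x; rewrite inE/= in_itv/= => /andP[x0 xt].
  rewrite clamp_id//; rewrite ger0_norm// in tB.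
  by rewrite ger0_norm//; lra.
congr (- _); apply: eq_Rintegral => x; rewrite inE/= in_itv/= => /andP[tx x0].
rewrite clamp_id//; rewrite ltr0_norm// in tB.
by rewrite ler0_norm//; lra.
Qed.

(** At each [t] the primitives of the truncations are equal to that of [f] as soon as [n >= |t|], so
    it is a pointwise limit of measurable functions. *)
Lemma measurable_primitive f : continuous f -> f 0 = 0 ->
  [locally [lipschitz f x | x in [set: R]]] ->
  measurable_fun setT (primitive f).
Proof.
move=> cf f0 lip.
apply: (@measurable_fun_cvg _ _ _ setT (fun n => primitive (f \o clamp n%:R))).
  by move=> n; have [L _ []] := truncated_lipschitz_pair cf f0 lip (ler0n R n).
move=> t _; apply: cvg_near_cst; near=> n; apply: primitive_clamp.
by near: n; exact: nbhs_infty_ger.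
Unshelve. all: by end_near. Qed.

Lemma half_form0r (V0 : R) u : half_form V0 u (fun=> 0) = 0.
Proof.
rewrite /half_form.
under eq_Rintegral do rewrite subrr mulr0 mul0r.
under [X in _ + _ * X]eq_Rintegral do rewrite mulr0.
by rewrite /Rintegral !integral0 !mulr0 addr0.
Qed.

Lemma half_formNC (V0 : R) u psi :
  half_form V0 (fun x => - u x) psi = half_form V0 u (fun x => - psi x).
Proof.
rewrite /half_form; congr (_ * _ + _ * _); apply: eq_Rintegral => x _.
  by ring.
by rewrite mulrN mulNr.
Qed.

Lemma null_superlevel_ae w B : measurable_fun setT w ->
  mu [set x | (B < w x)%R] = 0%E -> {ae mu, forall x, w x <= B}.
Proof.
move=> mw w0; exists [set x | B < w x]; split => //.
  exact: measurable_superlevel.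
by move=> x /= /negP; rewrite -ltNge.
Qed.

Lemma weak_bounded (V0 : R) w h z (c beta : R) : 0 <= V0 -> Hhalf w ->
  measurable_fun setT h -> Hhalf z -> 0 < beta -> 0 <= c ->
  (forall x, `|h x| <= c * expR (beta * z x ^+ 2)) ->
  (forall psi, Hhalf psi ->
    ((half_form V0 w psi)%:E = \int[mu]_x (h x * psi x)%:E)%E) ->
  exists B : R, {ae mu, forall x, `|w x| <= B}.
Proof.
move=> V00 wH mh zH b0 c0 hz weak; have /HhalfP[mw _ _] := wH.
have [B1 B10 hB1] := weak_bounded_above V00 wH mh zH b0 c0 hz weak.
have [] := @weak_bounded_above _ V0 (fun x => - w x) (fun x => - h x) z c beta
  V00 (HhalfN wH) _ zH b0 c0.
- exact: measurable_funN.
- by move=> x; rewrite normrN.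
- move=> psi psiH; rewrite half_formNC weak; last exact: HhalfN.
  by apply: eq_integral => x _; rewrite mulrN mulNr.
move=> B2 B20 hB2; exists (Num.max B1 B2).
have mNw := measurable_funN mw.
apply: filterS2 (null_superlevel_ae mw hB1) (null_superlevel_ae mNw hB2).
move=> x w1 /= w2.
have m1 : B1 <= Num.max B1 B2 by rewrite le_max lexx.
have m2 : B2 <= Num.max B1 B2 by rewrite le_max lexx orbT.
by rewrite ler_norml; apply/andP; split; lra.
Qed.

End truncation.

Section solution.
Context {R : realType}.
Notation mu := (@lebesgue_measure R).
Implicit Types f g u v : R -> R.

(** Taking one test function equal to 0 decouples the system: [u] solves an equation with right-hand
    side g(v), and [v] one with f(u), both of Gaussian growth with exponent 2 beta0. *)
Lemma solution_bounded (V0 beta0 : R) f g u v :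
  0 <= V0 -> 0 < beta0 -> continuous f -> continuous g ->
  `|f t| * expR (- (2 * beta0) * t ^+ 2) @[t --> abs_infty R] --> (0 : R) ->
  `|g t| * expR (- (2 * beta0) * t ^+ 2) @[t --> abs_infty R] --> (0 : R) ->
  weak_solution V0 f g u v ->
  exists B : R, {ae mu, forall x, `|u x| <= B /\ `|v x| <= B}.
Proof.
move=> V00 b0 cf cg fsub gsub [uH vH weak].
have /HhalfP[mfu _ _] := uH; have /HhalfP[mfv _ _] := vH.
have b2 : 0 < 2 * beta0 by rewrite mulr_gt0.
have [cF cF0 hF] := gaussian_growth cf (ltW b2) fsub.
have [cG cG0 hG] := gaussian_growth cg (ltW b2) gsub.
have mfu_ : measurable_fun setT (f \o u).
  by apply: measurableT_comp mfu; exact: continuous_measurable_fun.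
have mgv : measurable_fun setT (g \o v).
  by apply: measurableT_comp mfv; exact: continuous_measurable_fun.
have [B1 hB1] : exists B : R, {ae mu, forall x, `|u x| <= B}.
  apply: (weak_bounded V00 uH mgv vH b2 cG0) => [x|psi psiH]; first exact: hG.
  have := weak _ _ (@Hhalf0 R) psiH; rewrite half_form0r addr0 => ->.
  by apply: eq_integral => x _; rewrite mulr0 add0r.
have [B2 hB2] : exists B : R, {ae mu, forall x, `|v x| <= B}.
  apply: (weak_bounded V00 vH mfu_ uH b2 cF0) => [x|psi psiH]; first exact: hF.
  have := weak _ _ psiH (@Hhalf0 R); rewrite half_form0r add0r => ->.
  by apply: eq_integral => x _; rewrite mulr0 addr0.
have FF : Filter (almost_everywhere mu) := ae_filter_ringOfSetsType mu.
exists (Num.max B1 B2); move: hB1 hB2; apply: filterS2 => x h1 h2.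
by rewrite !le_max h1 h2 orbT.
Qed.

End solution.

Lemma lipschitz_pairW (R : realType) (L L' : R) (f F : R -> R) : L <= L' ->
  lipschitz_pair L f F -> lipschitz_pair L' f F.
Proof.
move=> LL [mf mF h1 h2 h3]; split => // [t|t|p q].
- by apply: (le_trans (h1 t)); rewrite ler_wpM2r.
- by apply: (le_trans (h2 t)); rewrite ler_wpM2r ?sqr_ge0.
- by apply: (le_trans (h3 p q)); rewrite ler_wpM2r ?sqr_ge0.
Qed.

Theorem theorem1p6 (R : realType) (V0 : R) (f g : R -> R)
  (mu M beta0 kappa0 r1 : R) (u v : R -> R)
  (V0_gt0 : 0 < V0)
  (f_lip : [locally [lipschitz f x | x in [set: R]]])
  (g_lip : [locally [lipschitz g x | x in [set: R]]])
  (f_cont : continuous f) (g_cont : continuous g)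
  (f_o : f =o_ (0^') (fun t : R => t ^+ 2))
  (g_o : g =o_ (0^') (fun t : R => t ^+ 2))
  (mu_gt2 : 2 < mu)
  (f_AR : forall t : R, t != 0 -> 0 <= mu * primitive f t <= t * f t)
  (g_AR : forall t : R, t != 0 -> 0 <= mu * primitive g t <= t * g t)
  (M_gt0 : 0 < M)
  (f_M : forall t : R, t != 0 -> 0 < primitive f t <= M * `|f t|)
  (g_M : forall t : R, t != 0 -> 0 < primitive g t <= M * `|g t|)
  (f_incr : forall s t : R, s != 0 -> t != 0 -> s < t -> f s / `|s| < f t / `|t|)
  (g_incr : forall s t : R, s != 0 -> t != 0 -> s < t -> g s / `|s| < g t / `|t|)
  (beta0_gt0 : 0 < beta0)
  (f_sub : forall beta : R, beta0 < beta ->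
     `|f t| * expR (- beta * t ^+ 2) @[t --> abs_infty R] --> 0)
  (g_sub : forall beta : R, beta0 < beta ->
     `|g t| * expR (- beta * t ^+ 2) @[t --> abs_infty R] --> 0)
  (f_super : forall beta : R, beta < beta0 ->
     `|f t| * expR (- beta * t ^+ 2) @[t --> abs_infty R] --> +oo)
  (g_super : forall beta : R, beta < beta0 ->
     `|g t| * expR (- beta * t ^+ 2) @[t --> abs_infty R] --> +oo)
  (kappa0_gt0 : 0 < kappa0) (r1_gt0 : 0 < r1)
  (kappa0_gt : Num.max (8 * expR (1 / 2) / beta0 * V0) (pi / (beta0 * r1))
               < kappa0)
  (f_liminf : (kappa0%:E <=
     limf_einf (fun t : R => (t * f t * expR (- beta0 * t ^+ 2))%:E)
       (abs_infty R))%E)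
  (g_liminf : (kappa0%:E <=
     limf_einf (fun t : R => (t * g t * expR (- beta0 * t ^+ 2))%:E)
       (abs_infty R))%E)
  (uv_sol : weak_solution V0 f g u v) :
  (\int[@lebesgue_measure R]_x
     (primitive f (u x) + primitive g (v x) - V0 * u x * v x)%:E = 0)%E.
Proof.
have V00 := ltW V0_gt0.
have f0 := littleo_sqr_eq0 f_cont f_o.
have g0 := littleo_sqr_eq0 g_cont g_o.
have b2 : beta0 < 2 * beta0 by lra.
have [uH vH weak] := uv_sol.
have [B0 aeB0] := solution_bounded V00 beta0_gt0 f_cont g_cont
  (f_sub _ b2) (g_sub _ b2) uv_sol.
have FF : Filter (almost_everywhere (@lebesgue_measure R)).
  exact: ae_filter_ringOfSetsType.
(* The bound [B0] has no prescribed sign, while [clamp] is used with a nonnegative level. *)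
pose B := Num.max 0 B0.
have B_ge0 : 0 <= B by rewrite /B le_max lexx.
have aeB : {ae (@lebesgue_measure R), forall x, `|u x| <= B /\ `|v x| <= B}.
  by move: aeB0; apply: filterS => x [h1 h2]; rewrite !le_max h1 h2 !orbT.
have [Lf Lf0 fF] := truncated_lipschitz_pair f_cont f0 f_lip B_ge0.
have [Lg Lg0 gG] := truncated_lipschitz_pair g_cont g0 g_lip B_ge0.
pose L := Num.max Lf Lg.
have L0 : 0 <= L by rewrite /L le_max Lf0.
have fL : lipschitz_pair L (f \o clamp B) (primitive (f \o clamp B)).
  by apply: lipschitz_pairW fF; rewrite /L le_max lexx.
have gL : lipschitz_pair L (g \o clamp B) (primitive (g \o clamp B)).
  by apply: lipschitz_pairW gG; rewrite /L le_max lexx orbT.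
have /HhalfP[mfu _ _] := uH; have /HhalfP[mfv _ _] := vH.
have mf := continuous_measurable_fun f_cont.
have mg := continuous_measurable_fun g_cont.
have [mfB _ _ _ _] := fL; have [mgB _ _ _ _] := gL.
(* As |u| and |v| are at most [B] almost everywhere, truncation does not change the right-hand side,
   and the same pair solves the Lipschitz system. *)
have ws : weak_solution V0 (f \o clamp B) (g \o clamp B) u v.
  split=> // phi psi phiH psiH; rewrite weak//.
  have /HhalfP[mphi _ _] := phiH; have /HhalfP[mpsi _ _] := psiH.
  apply: ae_eq_integral => //.
  - apply/measurable_EFinP; apply: measurable_funD; apply: measurable_funM =>
    //.
      exact: measurableT_comp mf mfu.
    exact: measurableT_comp mg mfv.
  - apply/measurable_EFinP; apply: measurable_funD; apply: measurable_funM =>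
    //.
      exact: measurableT_comp mfB mfu.
    exact: measurableT_comp mgB mfv.
  - by move: aeB; apply: filterS => x [h1 h2] _ /=; rewrite !clamp_id.
have [iH eH] := pohozaev_lipschitz V00 L0 fL gL ws.
transitivity (\int[@lebesgue_measure R]_x (primitive (f \o clamp B) (u x) +
    primitive (g \o clamp B) (v x) - V0 * u x * v x)%:E)%E; last first.
  by rewrite -(EFin_Rintegral iH) eH.
apply: ae_eq_integral => //.
- have mPf := measurable_primitive f_cont f0 f_lip.
  have mPg := measurable_primitive g_cont g0 g_lip.
  apply/measurable_EFinP; apply: measurable_funB.
    apply: measurable_funD; first exact: measurableT_comp mPf mfu.
    exact: measurableT_comp mPg mfv.
  by apply: measurable_funM => //; exact: measurable_funM.
- exact: measurable_int iH.
- by move: aeB; apply: filterS => x [h1 h2] _ /=; rewrite !primitive_clamp.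
Qed.
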